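(* Let $\mathcal{D}$ and $\mathcal{E}$ be weakly idempotent complete, weakly $(\omega,\mathbf{AdMon})$-elementary exact categories and let $F:\mathcal{D}\to\mathcal{E}$ be an additive functor. Suppose that $\mathcal{D}$ has kernels, that there exists an $F$-projective subcategory $\mathcal{S}\subset\mathcal{D}$, and that $F$ commutes with countable coproducts of objects in $\mathcal{S}$. Then there is an unbounded left derived functor $$\mathbb{L}F: D(\mathcal{D})\to D(\mathcal{E}),$$ that is, the functor $F:Ch(\mathcal{D})\to Ch(\mathcal{E})$ induced term-wise by $F$ has a total left derived functor.
   Context: An exact category is an additive category with a class of kernel-cokernel pairs (the short exact sequences) satisfying Quillen's axioms. Maps occurring as cokernels (resp. kernels) in short exact sequences are the admissible epimorphisms, $\mathbf{AdEpi}$ (resp. admissible monomorphisms, $\mathbf{AdMon}$). $Ch(\mathcal{E})$ is the category of unbounded complexes in $\mathcal{E}$ with homological grading. A complex is acyclic if each differential factors as $X_n\to Z_{n-1}\to X_{n-1}$ with $0\to Z_n\to X_n\to Z_{n-1}\to0$ short exact for all $n$; a quasi-isomorphism (weak equivalence) is a chain map with acyclic cone; $D(\mathcal{E})$ is the localization of $Ch(\mathcal{E})$ at quasi-isomorphisms, with localization functor $\gamma_{\mathcal{E}}:Ch(\mathcal{E})\to D(\mathcal{E})$. $\mathrm{Fun}_{\mathbf{AdMon}}(\omega,\mathcal{E})$ is the category of functors $G:\omega\to\mathcal{E}$ such that every $G(i)\to G(j)$ ($i\le j$) is an admissible monomorphism; a sequence in it is short exact if it is short exact at each $i\in\omega$.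 $\mathcal{E}$ is weakly $(\omega,\mathbf{AdMon})$-elementary if $\mathrm{colim}:\mathrm{Fun}_{\mathbf{AdMon}}(\omega,\mathcal{E})\to\mathcal{E}$ exists and is exact (sends short exact sequences to short exact sequences). A full subcategory $\mathcal{S}\subset\mathcal{D}$ is $F$-projective (left functorially adapted to $F$) if: (1) there are a functor $Q:\mathcal{D}\to\mathcal{S}$ and a natural transformation $\eta:i_{\mathcal{S}}\circ Q\to \mathrm{Id}_{\mathcal{D}}$, with $i_{\mathcal{S}}$ the inclusion, all of whose components are admissible epimorphisms; (2) $\mathcal{S}$ is closed under finite direct sums; (3) if $0\to X\to Y\to Z\to 0$ is exact with $Y,Z\in\mathcal{S}$, then $X\in\mathcal{S}$ and $0\to F(X)\to F(Y)\to F(Z)\to0$ is exact in $\mathcal{E}$. A total left derived functor of $F:Ch(\mathcal{D})\to Ch(\mathcal{E})$ is a right Kan extension of $\gamma_{\mathcal{E}}\circ F$ along $\gamma_{\mathcal{D}}$. *)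

(* Defs.v *)
From HB Require Import structures.
From mathcomp Require Import all_boot all_order all_algebra.
From mathcomp Require Import generic_quotient boolp.

Set Implicit Arguments.
Unset Strict Implicit.
Unset Printing Implicit Defensive.
Import GRing.Theory.
Local Open Scope ring_scope.
Local Open Scope quotient_scope.

(** * Categories, functors, natural transformations *)

Record category := Category {
  ob :> Type;
  hom : ob -> ob -> Type;
  idm : forall x, hom x x;
  comp : forall x y z, hom y z -> hom x y -> hom x z;
  comp1m : forall x y (f : hom x y), comp (idm y) f = f;
  compm1 : forall x y (f : hom x y), comp f (idm x) = f;
  compA : forall x y z t (h : hom z t) (g : hom y z) (f : hom x y),
    comp h (comp g f) = comp (comp h g) f }.
Arguments idm {c} x.

Declare Scope cat_scope.
Delimit Scope cat_scope with cat.
Notation "g ∘ f" := (comp g f) (at level 40, left associativity) : cat_scope.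
Open Scope cat_scope.

Definition is_iso (C : category) (x y : C) (f : hom x y) : Prop :=
  exists g : hom y x, g ∘ f = idm x /\ f ∘ g = idm y.

Record functor (C D : category) := Functor {
  fob :> C -> D;
  fmap : forall x y, hom x y -> hom (fob x) (fob y);
  fmap1 : forall x, fmap (idm x) = idm (fob x);
  fmapM : forall x y z (g : hom y z) (f : hom x y),
    fmap (g ∘ f) = fmap g ∘ fmap f }.

Definition idF (C : category) : functor C C.
Proof. by exists id (fun x y f => f). Defined.

Definition compF (C D E : category) (G : functor D E) (F : functor C D) :
  functor C E.
Proof.
exists (fun x => G (F x)) (fun x y f => fmap G (fmap F f)).
- by move=> x; rewrite !fmap1.
- by move=> x y z g f; rewrite !fmapM.
Defined.

Record nat_trans (C D : category) (F G : functor C D) := NatTrans {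
  nt :> forall x : C, hom (F x) (G x);
  ntP : forall (x y : C) (f : hom x y), nt y ∘ fmap F f = fmap G f ∘ nt x }.

Definition full_sub (C : category) (P : C -> Prop) : category.
Proof.
exists {x : C | P x} (fun x y => hom (sval x) (sval y))
  (fun x => idm (sval x)) (fun x y z g f => g ∘ f).
- by move=> x y f; rewrite comp1m.
- by move=> x y f; rewrite compm1.
- by move=> x y z t h g f; rewrite compA.
Defined.

Definition inclF (C : category) (P : C -> Prop) : functor (full_sub P) C.
Proof. by exists (fun x : full_sub P => sval x) (fun x y f => f). Defined.

Definition is_colimit (J C : category) (G : functor J C) (L : C)
    (c : forall j : J, hom (G j) L) : Prop :=
  (forall (i j : J) (u : hom i j), c j ∘ fmap G u = c i) /\
  forall (T : C) (t : forall j : J, hom (G j) T),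
    (forall (i j : J) (u : hom i j), t j ∘ fmap G u = t i) ->
    exists! h : hom L T, forall j : J, h ∘ c j = t j.

Definition is_coproduct (C : category) (I : Type) (X : I -> C) (L : C)
    (c : forall i, hom (X i) L) : Prop :=
  forall (T : C) (t : forall i, hom (X i) T),
    exists! h : hom L T, forall i, h ∘ c i = t i.

Definition is_pushout (C : category) (X Y X' Y' : C) (i : hom X Y)
    (f : hom X X') (i' : hom X' Y') (f' : hom Y Y') : Prop :=
  i' ∘ f = f' ∘ i /\
  forall (T : C) (a : hom X' T) (b : hom Y T), a ∘ f = b ∘ i ->
    exists! h : hom Y' T, h ∘ i' = a /\ h ∘ f' = b.

Definition is_pullback (C : category) (Y Z Y' Z' : C) (p : hom Y Z)
    (f : hom Z' Z) (p' : hom Y' Z') (f' : hom Y' Y) : Prop :=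
  f ∘ p' = p ∘ f' /\
  forall (T : C) (a : hom T Z') (b : hom T Y), f ∘ a = p ∘ b ->
    exists! h : hom T Y', p' ∘ h = a /\ f' ∘ h = b.

Definition omega : category.
Proof.
exists nat (fun i j => (i <= j)%N) leqnn
  (fun i j k (jk : (j <= k)%N) (ij : (i <= j)%N) => leq_trans ij jk);
  by move=> *; apply: bool_irrelevance.
Defined.

(** * Localization and derived functors *)

Definition mor_class (C : category) := forall x y : C, hom x y -> Prop.

(** The localization of [C] at [W] is presented, as in Gabriel and Zisman, by
    generators (the maps of [C] and formal inverses of the maps in [W]) and
    relations. *)
Inductive loc_term (C : category) (W : mor_class C) : C -> C -> Type :=
| loc_id x : loc_term W x x
| loc_comp x y z : loc_term W y z -> loc_term W x y -> loc_term W x z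
| loc_map x y : hom x y -> loc_term W x y
| loc_inv x y (w : hom x y) : W x y w -> loc_term W y x.
Arguments loc_id {C} W x.
Arguments loc_map {C} W {x y} _.

Inductive loc_rel (C : category) (W : mor_class C) :
    forall x y, loc_term W x y -> loc_term W x y -> Prop :=
| loc_refl x y (a : loc_term W x y) : loc_rel a a
| loc_sym x y (a b : loc_term W x y) : loc_rel a b -> loc_rel b a
| loc_trans x y (a b c : loc_term W x y) :
    loc_rel a b -> loc_rel b c -> loc_rel a c
| loc_congr x y z (a a' : loc_term W y z) (b b' : loc_term W x y) :
    loc_rel a a' -> loc_rel b b' -> loc_rel (loc_comp a b) (loc_comp a' b')
| loc_1m x y (a : loc_term W x y) : loc_rel (loc_comp (loc_id W y) a) a
| loc_m1 x y (a : loc_term W x y) : loc_rel (loc_comp a (loc_id W x)) a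
| loc_A x y z t (a : loc_term W z t) (b : loc_term W y z) (c : loc_term W x y) :
    loc_rel (loc_comp a (loc_comp b c)) (loc_comp (loc_comp a b) c)
| loc_map1 x : loc_rel (loc_map W (idm x)) (loc_id W x)
| loc_mapM x y z (g : hom y z) (f : hom x y) :
    loc_rel (loc_map W (g ∘ f)) (loc_comp (loc_map W g) (loc_map W f))
| loc_invl x y (w : hom x y) (Ww : W x y w) :
    loc_rel (loc_comp (loc_inv Ww) (loc_map W w)) (loc_id W x)
| loc_invr x y (w : hom x y) (Ww : W x y w) :
    loc_rel (loc_comp (loc_map W w) (loc_inv Ww)) (loc_id W y).

HB.instance Definition _ (C : category) (W : mor_class C) (x y : C) :=
  gen_eqMixin (loc_term W x y).
HB.instance Definition _ (C : category) (W : mor_class C) (x y : C) :=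
  gen_choiceMixin (loc_term W x y).

Lemma loc_equiv_class (C : category) (W : mor_class C) (x y : C) :
  equiv_class_of (fun a b : loc_term W x y => `[< loc_rel a b >]).
Proof.
split=> [a|a b|b a c].
- by apply/asboolP/loc_refl.
- by apply/asboolP/asboolP; apply: loc_sym.
- by move=> /asboolP ab /asboolP bc; apply/asboolP; apply: loc_trans ab bc.
Qed.

Canonical loc_equiv (C : category) (W : mor_class C) (x y : C) :=
  EquivRelPack (loc_equiv_class W x y).

Definition loc_hom (C : category) (W : mor_class C) (x y : C) : Type :=
  {eq_quot loc_equiv W x y}.

Definition loc_cl (C : category) (W : mor_class C) (x y : C)
  (a : loc_term W x y) : loc_hom W x y := \pi_({eq_quot loc_equiv W x y}) a.

Definition loc_repr (C : category) (W : mor_class C) (x y : C)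
  (u : loc_hom W x y) : loc_term W x y := repr u.

Lemma loc_reprK (C : category) (W : mor_class C) (x y : C)
  (u : loc_hom W x y) : loc_cl (loc_repr u) = u.
Proof. exact: reprK. Qed.

Lemma loc_clP (C : category) (W : mor_class C) (x y : C)
  (a b : loc_term W x y) : loc_cl a = loc_cl b <-> loc_rel a b.
Proof. by split=> [/eqmodP/asboolP|ab]; last exact/eqmodP/asboolP. Qed.

Definition loc_homM (C : category) (W : mor_class C) (x y z : C)
    (u : loc_hom W y z) (v : loc_hom W x y) : loc_hom W x z :=
  loc_cl (loc_comp (loc_repr u) (loc_repr v)).

Lemma loc_clM (C : category) (W : mor_class C) (x y z : C)
    (a : loc_term W y z) (b : loc_term W x y) :
  loc_cl (loc_comp a b) = loc_homM (loc_cl a) (loc_cl b).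
Proof. by apply/loc_clP/loc_congr; apply/loc_clP; rewrite loc_reprK. Qed.

Definition localization (C : category) (W : mor_class C) : category.
Proof.
refine (@Category C (loc_hom W) (fun x => loc_cl (loc_id W x))
  (@loc_homM C W) _ _ _).
- move=> x y u; rewrite -[u]loc_reprK -loc_clM; exact/loc_clP/loc_1m.
- move=> x y u; rewrite -[u]loc_reprK -loc_clM; exact/loc_clP/loc_m1.
- move=> x y z t h g f; rewrite -[h]loc_reprK -[g]loc_reprK -[f]loc_reprK.
  rewrite -!loc_clM; exact/loc_clP/loc_A.
Defined.

Definition locF (C : category) (W : mor_class C) : functor C (localization W).
Proof.
refine (@Functor C (localization W) id (fun x y f => loc_cl (loc_map W f)) _ _).
- move=> x; exact/loc_clP/loc_map1.
- move=> x y z g f; rewrite /= -loc_clM; exact/loc_clP/loc_mapM.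
Defined.

Definition inverts (C T : category) (W : mor_class C) (F : functor C T) :=
  forall (x y : C) (w : hom x y), W x y w -> is_iso (fmap F w).

Lemma locF_inverts (C : category) (W : mor_class C) : inverts W (locF W).
Proof.
move=> x y w Ww; exists (loc_cl (loc_inv Ww)).
by split; rewrite /= -loc_clM; apply/loc_clP; [exact: loc_invl|exact: loc_invr].
Qed.

Lemma functor_ext (C D : category) (o : C -> D)
    (m m' : forall x y : C, hom x y -> hom (o x) (o y)) h1 h2 h1' h2' :
  (forall x y (f : hom x y), m x y f = m' x y f) ->
  @Functor C D o m h1 h2 = @Functor C D o m' h1' h2'.
Proof.
move=> mm'; have E : m = m'.
  by do 3 (apply: functional_extensionality_dep => ?); exact: mm'.
by subst m'; congr Functor; exact: Prop_irrelevance.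
Qed.

Lemma nat_trans_ext (C D : category) (F G : functor C D) (a b : nat_trans F G) :
  (forall x, a x = b x) -> a = b.
Proof.
case: a b => [a ha] [b hb] /= ab.
have E : a = b by apply: functional_extensionality_dep.
by subst b; congr NatTrans; exact: Prop_irrelevance.
Qed.

Fixpoint loc_eval (C T : category) (W : mor_class C) (F : functor C T)
    (FW : inverts W F) (x y : C) (a : loc_term W x y) : hom (F x) (F y) :=
  match a in loc_term _ x y return hom (F x) (F y) with
  | loc_id x => idm (F x)
  | loc_comp _ _ _ a b => loc_eval FW a ∘ loc_eval FW b
  | loc_map _ _ f => fmap F f
  | loc_inv _ _ _ Ww => sval (cid (FW _ _ _ Ww))
  end.

Lemma loc_eval_rel (C T : category) (W : mor_class C) (F : functor C T)
    (FW : inverts W F) (x y : C) (a b : loc_term W x y) :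
  loc_rel a b -> loc_eval FW a = loc_eval FW b.
Proof.
elim=> //=.
- by move=> ? ? ? ? ? _ -> _ ->.
- by move=> ? ? ? ? ? ? ? _ -> _ ->.
- by move=> *; rewrite comp1m.
- by move=> *; rewrite compm1.
- by move=> *; rewrite compA.
- by move=> *; rewrite fmap1.
- by move=> *; rewrite fmapM.
- by move=> ? ? w Ww; case: cid => ? [].
- by move=> ? ? w Ww; case: cid => ? [].
Qed.

Lemma loc_eval_cl (C T : category) (W : mor_class C) (F : functor C T)
    (FW : inverts W F) (x y : C) (a : loc_term W x y) :
  loc_eval FW (loc_repr (loc_cl a)) = loc_eval FW a.
Proof. by apply/loc_eval_rel/loc_clP; rewrite loc_reprK. Qed.

Definition loc_lift (C T : category) (W : mor_class C) (F : functor C T)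
    (FW : inverts W F) : functor (localization W) T.
Proof.
refine (@Functor (localization W) T F (fun x y u => loc_eval FW (loc_repr u)) _ _).
- by move=> x; rewrite /= loc_eval_cl.
- by move=> x y z u v; rewrite /= loc_eval_cl.
Defined.

Lemma is_iso_inv_uniq (C : category) (x y : C) (f : hom x y) (g h : hom y x) :
  g ∘ f = idm x -> f ∘ h = idm y -> g = h.
Proof. by move=> gf fh; rewrite -[g]compm1 -fh compA gf comp1m. Qed.

Theorem localizationP (C T : category) (W : mor_class C) (F : functor C T) :
  inverts W F -> exists! G : functor (localization W) T, compF G (locF W) = F.
Proof.
move=> FW; exists (loc_lift FW); split.
  case: F FW => o m h1 h2 FW; apply: functor_ext => x y f /=.
  exact: (loc_eval_cl FW (loc_map W f)).
move=> G GF; subst F; case: G FW => o m h1 h2 FW; apply: functor_ext => x y u.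
rewrite -[u]loc_reprK; move: (loc_repr u) => {u} a; rewrite /= loc_eval_cl.
elim: a => {x y} [x|x y z a IHa b IHb|x y f|x y w Ww] //=.
- by rewrite IHa IHb loc_clM; exact/esym/h2.
- case: cid => g [gw wg] /=; apply: (is_iso_inv_uniq gw).
  rewrite /= -h2 -h1 /= -loc_clM; congr m; exact/loc_clP/loc_invr.
Qed.

Definition is_right_kan (C C' T : category) (K : functor C C')
    (G : functor C T) (R : functor C' T) (eps : nat_trans (compF R K) G) : Prop :=
  forall (H : functor C' T) (al : nat_trans (compF H K) G),
    exists! be : nat_trans H R, forall x : C, eps x ∘ be (K x) = al x.

Definition has_total_left_derived (C D : category) (WC : mor_class C)
    (WD : mor_class D) (F : functor C D) : Prop :=
  exists (LF : functor (localization WC) (localization WD))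
         (eps : nat_trans (compF LF (locF WC)) (compF (locF WD) F)),
    is_right_kan eps.

(** * Additive categories *)

Record homZmod := HomZmod {
  hz_cat :> category;
  hz_class : forall x y : hz_cat, GRing.Zmodule (hom x y) }.
HB.instance Definition _ (A : homZmod) (x y : A) := hz_class x y.

Record preadditive := Preadditive {
  pre_cat :> homZmod;
  compDl : forall (x y z : pre_cat) (g g' : hom y z) (f : hom x y),
    (g + g') ∘ f = g ∘ f + g' ∘ f;
  compDr : forall (x y z : pre_cat) (g : hom y z) (f f' : hom x y),
    g ∘ (f + f') = g ∘ f + g ∘ f' }.

Lemma comp0m (A : preadditive) (x y z : A) (f : hom x y) :
  (0 : hom y z) ∘ f = 0.
Proof. by apply: (addrI (0 ∘ f)); rewrite -compDl !addr0. Qed.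

Lemma compm0 (A : preadditive) (x y z : A) (g : hom y z) :
  g ∘ (0 : hom x y) = 0.
Proof. by apply: (addrI (g ∘ 0)); rewrite -compDr !addr0. Qed.

Lemma compNm (A : preadditive) (x y z : A) (g : hom y z) (f : hom x y) :
  (- g) ∘ f = - (g ∘ f).
Proof. by apply/eqP; rewrite -addr_eq0 -compDl addNr comp0m. Qed.

Lemma compmN (A : preadditive) (x y z : A) (g : hom y z) (f : hom x y) :
  g ∘ (- f) = - (g ∘ f).
Proof. by apply/eqP; rewrite -addr_eq0 -compDr addNr compm0. Qed.

Record additiveCat := AdditiveCat {
  add_cat :> preadditive;
  zob : add_cat;
  zob_final : forall (x : add_cat) (f : hom x zob), f = 0;
  zob_initial : forall (x : add_cat) (f : hom zob x), f = 0;
  bip : add_cat -> add_cat -> add_cat;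
  inl_ : forall x y, hom x (bip x y);
  inr_ : forall x y, hom y (bip x y);
  prl : forall x y, hom (bip x y) x;
  prr : forall x y, hom (bip x y) y;
  prl_inl : forall x y, prl x y ∘ inl_ x y = idm x;
  prr_inr : forall x y, prr x y ∘ inr_ x y = idm y;
  prl_inr : forall x y, prl x y ∘ inr_ x y = 0;
  prr_inl : forall x y, prr x y ∘ inl_ x y = 0;
  bip_id : forall x y,
    inl_ x y ∘ prl x y + inr_ x y ∘ prr x y = idm (bip x y) }.
Arguments zob {a}.
Arguments inl_ {a x y}.
Arguments inr_ {a x y}.
Arguments prl {a x y}.
Arguments prr {a x y}.
Notation "x ⊕ y" := (bip x y) (at level 50, left associativity) : cat_scope.

Definition is_kernel (A : additiveCat) (k x y : A) (i : hom k x) (p : hom x y) :=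
  p ∘ i = 0 /\
  forall (t : A) (f : hom t x), p ∘ f = 0 -> exists! g : hom t k, i ∘ g = f.

Definition is_cokernel (A : additiveCat) (x y q : A) (i : hom x y) (p : hom y q) :=
  p ∘ i = 0 /\
  forall (t : A) (f : hom y t), f ∘ i = 0 -> exists! g : hom q t, g ∘ p = f.

Definition has_kernels (A : additiveCat) : Prop :=
  forall (x y : A) (p : hom x y), exists (k : A) (i : hom k x), is_kernel i p.

Definition weakly_idempotent_complete (A : additiveCat) : Prop :=
  forall (x y : A) (r : hom x y) (s : hom y x), r ∘ s = idm y ->
    exists (k : A) (i : hom k x), is_kernel i r.

Record additiveFunctor (A B : additiveCat) := AdditiveFunctor {
  add_fun :> functor A B;
  fmapD : forall (x y : A) (f g : hom x y),
    fmap add_fun (f + g) = fmap add_fun f + fmap add_fun g }.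

Lemma fmap0 (A B : additiveCat) (F : additiveFunctor A B) (x y : A) :
  fmap F (0 : hom x y) = 0.
Proof. by apply: (addrI (fmap F 0)); rewrite -fmapD !addr0. Qed.

(** * Exact categories *)

Definition pair_class (A : additiveCat) :=
  forall x y z : A, hom x y -> hom y z -> Prop.

Definition is_adm_mono (A : additiveCat) (E : pair_class A) (x y : A)
  (i : hom x y) : Prop := exists (z : A) (p : hom y z), E x y z i p.

Definition is_adm_epi (A : additiveCat) (E : pair_class A) (y z : A)
  (p : hom y z) : Prop := exists (x : A) (i : hom x y), E x y z i p.

(** Quillen's axioms, in Bühler's formulation. *)
Record exactCat := ExactCat {
  ex_cat :> additiveCat;
  ses : pair_class ex_cat;
  ses_kernel : forall (x y z : ex_cat) (i : hom x y) (p : hom y z),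
    ses i p -> is_kernel i p;
  ses_cokernel : forall (x y z : ex_cat) (i : hom x y) (p : hom y z),
    ses i p -> is_cokernel i p;
  ses_iso : forall (x y z x' y' z' : ex_cat) (i : hom x y) (p : hom y z)
      (i' : hom x' y') (p' : hom y' z')
      (a : hom x x') (b : hom y y') (c : hom z z'),
    is_iso a -> is_iso b -> is_iso c -> i' ∘ a = b ∘ i -> p' ∘ b = c ∘ p ->
    ses i p -> ses i' p';
  adm_mono1 : forall x : ex_cat, is_adm_mono ses (idm x);
  adm_epi1 : forall x : ex_cat, is_adm_epi ses (idm x);
  adm_monoM : forall (x y z : ex_cat) (j : hom y z) (i : hom x y),
    is_adm_mono ses j -> is_adm_mono ses i -> is_adm_mono ses (j ∘ i);
  adm_epiM : forall (x y z : ex_cat) (q : hom y z) (p : hom x y),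
    is_adm_epi ses q -> is_adm_epi ses p -> is_adm_epi ses (q ∘ p);
  adm_mono_pushout : forall (x y x' : ex_cat) (i : hom x y) (f : hom x x'),
    is_adm_mono ses i ->
    exists (y' : ex_cat) (i' : hom x' y') (f' : hom y y'),
      is_pushout i f i' f' /\ is_adm_mono ses i';
  adm_epi_pullback : forall (y z z' : ex_cat) (p : hom y z) (f : hom z' z),
    is_adm_epi ses p ->
    exists (y' : ex_cat) (p' : hom y' z') (f' : hom y' y),
      is_pullback p f p' f' /\ is_adm_epi ses p' }.

Definition adm_mono (E : exactCat) (x y : E) (i : hom x y) : Prop :=
  is_adm_mono (@ses E) i.
Definition adm_epi (E : exactCat) (x y : E) (p : hom x y) : Prop :=
  is_adm_epi (@ses E) p.

Definition fun_adm_mono (E : exactCat) (G : functor omega E) : Prop :=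
  forall (i j : omega) (u : hom i j), adm_mono (fmap G u).

Definition colim_exact (E : exactCat) : Prop :=
  forall (G' G G'' : functor omega E) (al : nat_trans G' G)
      (be : nat_trans G G''),
    fun_adm_mono G' -> fun_adm_mono G -> fun_adm_mono G'' ->
    (forall i, ses (al i) (be i)) ->
  forall (L' L L'' : E) (c' : forall i, hom (G' i) L')
      (c : forall i, hom (G i) L) (c'' : forall i, hom (G'' i) L''),
    is_colimit c' -> is_colimit c -> is_colimit c'' ->
  forall (a : hom L' L) (b : hom L L''),
    (forall i, a ∘ c' i = c i ∘ al i) -> (forall i, b ∘ c i = c'' i ∘ be i) ->
    ses a b.

Definition weakly_omega_elementary (E : exactCat) : Prop :=
  (forall G : functor omega E, fun_adm_mono G ->
     exists (L : E) (c : forall i, hom (G i) L), is_colimit c) /\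
  colim_exact E.

(** By [proj_zob] and [proj_ses], [S] is replete ([0 -> x -> y -> 0 -> 0] is
    exact for [x] isomorphic to [y]), so asking for the chosen zero object and
    biproducts amounts to asking for all of them. *)
Record projective_subcat (D E : exactCat) (F : functor D E) (S : D -> Prop) :
    Prop := ProjectiveSubcat {
  proj_cover : exists (Q : functor D (full_sub S))
      (eta : nat_trans (compF (inclF S) Q) (idF D)),
    forall x : D, adm_epi (eta x);
  proj_zob : S zob;
  proj_bip : forall x y : D, S x -> S y -> S (x ⊕ y);
  proj_ses : forall (x y z : D) (i : hom x y) (p : hom y z),
    ses i p -> S y -> S z -> S x /\ ses (fmap F i) (fmap F p) }.

Definition preserves_countable_coproducts (D E : category) (F : functor D E)
    (S : D -> Prop) : Prop :=
  forall (I : countType) (X : I -> D) (L : D) (c : forall i, hom (X i) L),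
    (forall i, S (X i)) -> is_coproduct c -> is_coproduct (fun i => fmap F (c i)).

(** * Unbounded chain complexes *)

Record complex (A : additiveCat) := Complex {
  cx :> int -> A;
  cd : forall n, hom (cx n) (cx (n - 1));
  cdd : forall n, cd (n - 1) ∘ cd n = 0 }.
Arguments cd {A} c n.

Record chain_map (A : additiveCat) (X Y : complex A) := ChainMap {
  cm :> forall n, hom (X n) (Y n);
  cmP : forall n, cd Y n ∘ cm n = cm (n - 1) ∘ cd X n }.

Lemma chain_map_ext (A : additiveCat) (X Y : complex A) (f g : chain_map X Y) :
  (forall n, f n = g n) -> f = g.
Proof.
case: f g => [f hf] [g hg] /= fg.
have E : f = g by apply: functional_extensionality_dep.
by subst g; congr ChainMap; exact: Prop_irrelevance.
Qed.

Definition chain_id (A : additiveCat) (X : complex A) : chain_map X X.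
Proof. by exists (fun n => idm (X n)) => n; rewrite comp1m compm1. Defined.

Definition chain_comp (A : additiveCat) (X Y Z : complex A)
  (g : chain_map Y Z) (f : chain_map X Y) : chain_map X Z.
Proof.
by exists (fun n => g n ∘ f n) => n; rewrite compA cmP -compA cmP compA.
Defined.

Definition Ch (A : additiveCat) : category.
Proof.
refine (@Category (complex A) (@chain_map A) (@chain_id A) (@chain_comp A) _ _ _).
- by move=> x y f; apply: chain_map_ext => n; apply: comp1m.
- by move=> x y f; apply: chain_map_ext => n; apply: compm1.
- by move=> x y z t h g f; apply: chain_map_ext => n; apply: compA.
Defined.

Definition cx_map (A B : additiveCat) (F : additiveFunctor A B)
  (X : complex A) : complex B.
Proof.
exists (fun n => F (X n)) (fun n => fmap F (cd X n)) => n.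
by rewrite -fmapM cdd fmap0.
Defined.

Definition ChF (A B : additiveCat) (F : additiveFunctor A B) :
  functor (Ch A) (Ch B).
Proof.
unshelve refine (@Functor (Ch A) (Ch B) (@cx_map A B F) (fun X Y f =>
  @ChainMap B (cx_map F X) (cx_map F Y) (fun n => fmap F (cm f n)) _) _ _).
- by move=> n; rewrite /= -!fmapM cmP.
- by move=> X; apply: chain_map_ext => n; apply: fmap1.
- by move=> X Y Z g f; apply: chain_map_ext => n; apply: fmapM.
Defined.

Definition cone_d (A : additiveCat) (X Y : complex A) (f : chain_map X Y)
    (n : int) : hom (Y n ⊕ X (n - 1)) (Y (n - 1) ⊕ X (n - 1 - 1)) :=
  inl_ ∘ (cd Y n ∘ prl + f (n - 1) ∘ prr) - inr_ ∘ (cd X (n - 1) ∘ prr).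

Lemma cone_dd (A : additiveCat) (X Y : complex A) (f : chain_map X Y) (n : int) :
  cone_d f (n - 1) ∘ cone_d f n = 0.
Proof.
rewrite /cone_d !(compDl, compDr, compNm, compmN) -!compA.
rewrite !(compA prl) !(compA prr).
rewrite !(prl_inl, prr_inr, prl_inr, prr_inl, comp0m, comp1m, compm0).
rewrite !(compA (cd Y _) (cd Y _)) !(compA (cd X _) (cd X _)) !cdd.
rewrite !(comp0m, compm0) !(subr0, sub0r, addr0, add0r, oppr0).
by rewrite (compA (cd Y _) (f _)) cmP -compA subrr.
Qed.

Definition cone (A : additiveCat) (X Y : complex A) (f : chain_map X Y) :
  complex A := Complex (cone_dd f).

Definition acyclic (E : exactCat) (X : complex E) : Prop :=
  exists (Z : int -> E) (i : forall n, hom (Z n) (X n))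
         (p : forall n, hom (X n) (Z (n - 1))),
    forall n, cd X n = i (n - 1) ∘ p n /\ ses (i n) (p n).

Definition quasi_iso (E : exactCat) : mor_class (Ch E) :=
  fun X Y f => acyclic (cone f).

(* Main.v *)
(** Let [Z n X] be the cycles of [X]. A complex is the colimit of its good
    truncations [.. -> X (n + 1) -> Z n X -> 0]; each of them is bounded below
    and is resolved by objects of [S], adding in each degree the functorial
    cover [Q] of the cycles of the cone constructed so far. Resolving
    the [k + 1]-st truncation relatively to the resolution of the [k]-th one
    makes the resolutions an increasing sequence, degreewise split with
    complements in [S]; their colimit [P X] is quasi-isomorphic to [X] by
    exactness of colimits of admissible monomorphisms.

    A bounded below acyclic complex in [S] has its cycles in [S], so [F]
    preserves it; as [F] preserves countable coproducts of objects of [S], it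
    preserves the acyclicity of a colimit of a degreewise split sequence of
    such complexes. Thus [F P] preserves quasi-isomorphisms.

    It remains to see that [F] inverts [P (P X) -> P X]. The comparison of
    [P (P X)] with the given filtration of [P X] is only one-sided: resolving
    that filtration itself gives [A -> P (P X)] such that [F] inverts
    [A -> P (P X) -> P X]. Hence [F (P (P X)) -> F (P X)] is a split
    epimorphism for all [X], and this together with naturality forces
    it to be invertible. *)

From HB Require Import structures.
From mathcomp Require Import all_boot all_order all_algebra.
From mathcomp Require Import boolp.
Require Import Defs.

Set Implicit Arguments.
Unset Strict Implicit.
Unset Printing Implicit Defensive.
Import GRing.Theory.
Local Open Scope ring_scope.

Definition monic (C : category) (x y : C) (f : hom x y) : Prop :=
  forall (t : C) (g h : hom t x), f ∘ g = f ∘ h -> g = h.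
Definition epic (C : category) (x y : C) (f : hom x y) : Prop :=
  forall (t : C) (g h : hom y t), g ∘ f = h ∘ f -> g = h.

Lemma is_iso1 (C : category) (x : C) : is_iso (idm x).
Proof. by exists (idm x); rewrite comp1m. Qed.

Section Additive.
Variable A : additiveCat.
Implicit Types x y z t : A.

Definition pairm x y t (f : hom t x) (g : hom t y) : hom t (x ⊕ y) :=
  inl_ ∘ f + inr_ ∘ g.
Definition copairm x y t (f : hom x t) (g : hom y t) : hom (x ⊕ y) t :=
  f ∘ prl + g ∘ prr.

Lemma prl_pairm x y t (f : hom t x) (g : hom t y) : prl ∘ pairm f g = f.
Proof. by rewrite compDr !compA prl_inl prl_inr comp0m comp1m addr0. Qed.

Lemma prr_pairm x y t (f : hom t x) (g : hom t y) : prr ∘ pairm f g = g.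
Proof. by rewrite compDr !compA prr_inl prr_inr comp0m comp1m add0r. Qed.

Lemma copairm_inl x y t (f : hom x t) (g : hom y t) : copairm f g ∘ inl_ = f.
Proof. by rewrite compDl -!compA prl_inl prr_inl compm0 compm1 addr0. Qed.

Lemma copairm_inr x y t (f : hom x t) (g : hom y t) : copairm f g ∘ inr_ = g.
Proof. by rewrite compDl -!compA prl_inr prr_inr compm0 compm1 add0r. Qed.

Lemma bip_ext_to x y t (f g : hom t (x ⊕ y)) :
  prl ∘ f = prl ∘ g -> prr ∘ f = prr ∘ g -> f = g.
Proof.
move=> el er; rewrite -[f]comp1m -[g]comp1m -!bip_id !compDl -!compA.
by rewrite el er.
Qed.

Lemma bip_ext_from x y t (f g : hom (x ⊕ y) t) :
  f ∘ inl_ = g ∘ inl_ -> f ∘ inr_ = g ∘ inr_ -> f = g.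
Proof.
move=> el er; rewrite -[f]compm1 -[g]compm1 -!bip_id !compDr !compA.
by rewrite el er.
Qed.

Lemma comp_copairm x y t z (h : hom t z) (f : hom x t) (g : hom y t) :
  h ∘ copairm f g = copairm (h ∘ f) (h ∘ g).
Proof. by rewrite /copairm compDr !compA. Qed.

Lemma pairm_comp x y t z (h : hom z t) (f : hom t x) (g : hom t y) :
  pairm f g ∘ h = pairm (f ∘ h) (g ∘ h).
Proof. by rewrite /pairm compDl -!compA. Qed.

Lemma copairm_pairm x y t z (f : hom x t) (g : hom y t) (a : hom z x)
  (b : hom z y) : copairm f g ∘ pairm a b = f ∘ a + g ∘ b.
Proof. by rewrite compDl -!compA prl_pairm prr_pairm. Qed.

Definition bimap x y x' y' (f : hom x x') (g : hom y y') :
  hom (x ⊕ y) (x' ⊕ y') := pairm (f ∘ prl) (g ∘ prr).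

Lemma prl_bimap x y x' y' (f : hom x x') (g : hom y y') :
  prl ∘ bimap f g = f ∘ prl.
Proof. exact: prl_pairm. Qed.

Lemma prr_bimap x y x' y' (f : hom x x') (g : hom y y') :
  prr ∘ bimap f g = g ∘ prr.
Proof. exact: prr_pairm. Qed.

Lemma bimap_inl x y x' y' (f : hom x x') (g : hom y y') :
  bimap f g ∘ inl_ = inl_ ∘ f.
Proof.
apply: bip_ext_to; rewrite !compA ?prl_bimap ?prr_bimap -compA.
- by rewrite prl_inl prl_inl compm1 comp1m.
- by rewrite prr_inl prr_inl compm0 comp0m.
Qed.

Lemma bimap_inr x y x' y' (f : hom x x') (g : hom y y') :
  bimap f g ∘ inr_ = inr_ ∘ g.
Proof.
apply: bip_ext_to; rewrite !compA ?prl_bimap ?prr_bimap -compA.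
- by rewrite prl_inr prl_inr compm0 comp0m.
- by rewrite prr_inr prr_inr compm1 comp1m.
Qed.

Lemma bimap_comp x y x' y' x'' y'' (f : hom x x') (g : hom y y')
    (f' : hom x' x'') (g' : hom y' y'') :
  bimap f' g' ∘ bimap f g = bimap (f' ∘ f) (g' ∘ g).
Proof.
by apply: bip_ext_to; rewrite compA ?prl_bimap ?prr_bimap -compA
  ?prl_bimap ?prr_bimap compA.
Qed.

Lemma bimap1 x y : bimap (idm x) (idm y) = idm (x ⊕ y).
Proof. by rewrite /bimap /pairm !comp1m bip_id. Qed.

Definition is_zero x := idm x = 0.

Lemma zob_zero : is_zero (zob : A).
Proof. exact: zob_final. Qed.

Lemma from_zero x y (f g : hom x y) : is_zero x -> f = g.
Proof. by move=> x0; rewrite -[f]compm1 -[g]compm1 x0 !compm0. Qed.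

Lemma to_zero x y (f g : hom x y) : is_zero y -> f = g.
Proof. by move=> y0; rewrite -[f]comp1m -[g]comp1m y0 !comp0m. Qed.

Lemma kernel_monic k x y (i : hom k x) (p : hom x y) : is_kernel i p -> monic i.
Proof.
move=> [pi ker] t g h e.
have [|u [_ U]] := ker t (i ∘ g); first by rewrite compA pi comp0m.
by rewrite -(U g erefl) -(U h (esym e)).
Qed.

Lemma cokernel_epic x y q (i : hom x y) (p : hom y q) : is_cokernel i p -> epic p.
Proof.
move=> [pi cok] t g h e.
have [|u [_ U]] := cok t (g ∘ p); first by rewrite -compA pi compm0.
by rewrite -(U g erefl) -(U h (esym e)).
Qed.

Lemma kernel_lift k x y (i : hom k x) (p : hom x y) t (f : hom t x) :
  is_kernel i p -> p ∘ f = 0 -> exists g, i ∘ g = f.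
Proof. by move=> [_ ker] /ker [g [<- _]]; exists g. Qed.

Lemma cokernel_desc x y q (i : hom x y) (p : hom y q) t (f : hom y t) :
  is_cokernel i p -> f ∘ i = 0 -> exists g, g ∘ p = f.
Proof. by move=> [_ cok] /cok [g [<- _]]; exists g. Qed.

Lemma kernelI k x y (i : hom k x) (p : hom x y) : p ∘ i = 0 -> monic i ->
  (forall t (f : hom t x), p ∘ f = 0 -> exists g, i ∘ g = f) -> is_kernel i p.
Proof.
move=> pi im H; split=> // t f /H [g gf]; exists g; split=> // h hf.
by apply: im; rewrite gf hf.
Qed.

Lemma cokernelI x y q (i : hom x y) (p : hom y q) : p ∘ i = 0 -> epic p ->
  (forall t (f : hom y t), f ∘ i = 0 -> exists g, g ∘ p = f) -> is_cokernel i p.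
Proof.
move=> pi pe H; split=> // t f /H [g gf]; exists g; split=> // h hf.
by apply: pe; rewrite gf hf.
Qed.

Lemma kernel_uniq k k' x y (i : hom k x) (i' : hom k' x) (p : hom x y) :
  is_kernel i p -> is_kernel i' p -> exists a : hom k k', is_iso a /\ i' ∘ a = i.
Proof.
move=> K K'; have [a ai] := kernel_lift K' K.1.
have [b bi] := kernel_lift K K'.1; exists a; split=> //; exists b; split.
- by apply: (kernel_monic K); rewrite compA bi ai compm1.
- by apply: (kernel_monic K'); rewrite compA ai bi compm1.
Qed.

Lemma cokernel_uniq x y q q' (i : hom x y) (p : hom y q) (p' : hom y q') :
  is_cokernel i p -> is_cokernel i p' -> exists a : hom q q', is_iso a /\ a ∘ p = p'.
Proof.
move=> K K'; have [a ai] := cokernel_desc K K'.1.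
have [b bi] := cokernel_desc K' K.1; exists a; split=> //; exists b; split.
- by apply: (cokernel_epic K); rewrite -compA ai bi comp1m.
- by apply: (cokernel_epic K'); rewrite -compA bi ai comp1m.
Qed.

Definition biproduct_of x y z (i : hom x y) (j : hom z y) (r : hom y x)
    (p : hom y z) : Prop :=
  [/\ r ∘ i = idm x, p ∘ j = idm z, r ∘ j = 0, p ∘ i = 0 &
      i ∘ r + j ∘ p = idm y].

Lemma biproduct_bip x y : biproduct_of (@inl_ A x y) inr_ prl prr.
Proof.
by split; rewrite ?prl_inl ?prr_inr ?prl_inr ?prr_inl ?bip_id.
Qed.

Lemma biproduct_id x : biproduct_of (idm x) (0 : hom zob x) (idm x) 0.
Proof.
split; rewrite ?comp0m ?compm0 ?comp1m ?addr0 //; exact/esym/zob_zero.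
Qed.

Lemma biproduct_ext x y z t i j r p (f g : hom y t) : @biproduct_of x y z i j r p ->
  f ∘ i = g ∘ i -> f ∘ j = g ∘ j -> f = g.
Proof.
move=> [_ _ _ _ e] ei ej; rewrite -[f]compm1 -[g]compm1 -e !compDr !compA.
by rewrite ei ej.
Qed.

Lemma biproduct_bimap x y z i j r p x' y' z' i' j' r' p' :
  @biproduct_of x y z i j r p -> @biproduct_of x' y' z' i' j' r' p' ->
  biproduct_of (bimap i i') (bimap j j') (bimap r r') (bimap p p').
Proof.
have bm0 a b c d : bimap (0 : hom a b) (0 : hom c d) = 0.
  by rewrite /bimap !comp0m /pairm !compm0 addr0.
move=> [e1 e2 e3 e4 e5] [f1 f2 f3 f4 f5].
split; rewrite !bimap_comp ?e1 ?e2 ?e3 ?e4 ?f1 ?f2 ?f3 ?f4 ?bimap1 ?bm0 //.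
apply: bip_ext_to; rewrite compDr ?prl_bimap ?prr_bimap -compDl ?e5 ?f5;
  by rewrite comp1m compm1.
Qed.

End Additive.

Section Exact.
Variable A : exactCat.
Implicit Types x y z t : A.

Lemma ses_monic x y z (i : hom x y) (p : hom y z) : ses i p -> monic i.
Proof. by move/ses_kernel/kernel_monic. Qed.

Lemma ses_epic x y z (i : hom x y) (p : hom y z) : ses i p -> epic p.
Proof. by move/ses_cokernel/cokernel_epic. Qed.

Lemma ses_of_epi x y z (i : hom x y) (p : hom y z) :
  adm_epi p -> is_kernel i p -> ses i p.
Proof.
move=> [k [j jp]] K; have [a [ai ae]] := kernel_uniq (ses_kernel jp) K.
apply: (ses_iso ai (is_iso1 y) (is_iso1 z) _ _ jp).
- by rewrite ae comp1m.
- by rewrite comp1m compm1.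
Qed.

Lemma ses_of_mono x y z (i : hom x y) (p : hom y z) :
  adm_mono i -> is_cokernel i p -> ses i p.
Proof.
move=> [k [j jp]] K; have [a [ai ae]] := cokernel_uniq (ses_cokernel jp) K.
apply: (ses_iso (is_iso1 x) (is_iso1 y) ai _ _ jp).
- by rewrite compm1 comp1m.
- by rewrite ae compm1.
Qed.

Lemma ses_0id x z : is_zero z -> ses (0 : hom z x) (idm x).
Proof.
move=> z0; apply: ses_of_epi; first exact: adm_epi1.
apply: kernelI; first by rewrite compm0.
- by move=> t g h _; apply: to_zero.
- by move=> t f; rewrite comp1m => ->; exists 0; rewrite compm0.
Qed.

Lemma ses_id0 x z : is_zero z -> ses (idm x) (0 : hom x z).
Proof.
move=> z0; apply: ses_of_mono; first exact: adm_mono1.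
apply: cokernelI; first by rewrite comp0m.
- by move=> t g h _; apply: from_zero.
- by move=> t f; rewrite compm1 => ->; exists 0; rewrite compm0.
Qed.

Lemma adm_epi_iso x y (f : hom x y) : is_iso f -> adm_epi f.
Proof.
move=> fi; exists zob, 0.
apply: (ses_iso (is_iso1 _) (is_iso1 _) fi _ _ (ses_0id x (zob_zero A))).
- by rewrite !compm0 comp0m.
- by [].
Qed.

Lemma adm_mono_isol x y z (f : hom y z) (i : hom x y) :
  is_iso f -> adm_mono i -> adm_mono (f ∘ i).
Proof.
move=> fi [q [p ip]]; case: (fi) => g [gf fg]; exists q, (p ∘ g).
apply: (ses_iso (is_iso1 _) fi (is_iso1 _) _ _ ip); first by rewrite compm1.
by rewrite -compA gf compm1 comp1m.
Qed.

Lemma ses_inl_prr x y : ses (@inl_ A x y) prr.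
Proof.
apply: ses_of_mono; last first.
  apply: cokernelI; first exact: prr_inl.
  - move=> t g h e.
    by rewrite -[g]compm1 -[h]compm1 -(prr_inr x y) !compA e.
  - move=> t f f0; exists (f ∘ inr_); apply: bip_ext_from; rewrite -!compA.
      by rewrite prr_inl !compm0 f0.
    by rewrite prr_inr compm1.
have mz : adm_mono (0 : hom (zob : A) y) by exists y, (idm y); apply: ses_0id; apply: zob_zero.
have [w [i' [f' [[e U] mi]]]] := adm_mono_pushout (0 : hom zob x) mz.
have [|g [[gi gf] _]] := U (x ⊕ y) inl_ inr_; first by rewrite !compm0.
rewrite -gi; apply: adm_mono_isol => //; exists (copairm i' f'); split.
- have [//|u [_ Uu]] := U w i' f'.
  rewrite -(Uu (copairm i' f' ∘ g)).
    by apply: Uu; rewrite !comp1m.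
  by rewrite -!compA gi gf copairm_inl copairm_inr.
- by apply: bip_ext_from; rewrite -!compA ?copairm_inl ?copairm_inr comp1m.
Qed.

Lemma ses_biproduct x y z i j r p : @biproduct_of A x y z i j r p -> ses i p.
Proof.
move=> [ri pj rj pi e].
have bi : is_iso (copairm i j).
  exists (pairm r p); split; last by rewrite copairm_pairm e.
  apply: bip_ext_from; rewrite -compA ?copairm_inl ?copairm_inr pairm_comp
    ?ri ?pi ?rj ?pj /pairm ?compm0 ?compm1 ?addr0 ?add0r comp1m //.
apply: (ses_iso (is_iso1 x) bi (is_iso1 z) _ _ (ses_inl_prr x z)).
- by rewrite copairm_inl compm1.
- by rewrite comp_copairm pi pj /copairm comp0m add0r.
Qed.

Lemma adm_mono_biproduct x y z i j r p :
  @biproduct_of A x y z i j r p -> adm_mono i.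
Proof. by move/ses_biproduct; exists z, p. Qed.

(** The square [m, φ, f, κ] below is a pushout: this exhibits [κ] as an
    admissible monomorphism. *)
Lemma adm_epi_factor x y z (f : hom x y) (g : hom y z) k (κ : hom k y) :
  is_kernel κ g -> adm_epi (g ∘ f) -> adm_epi g.
Proof.
move=> K gfe; have km := kernel_monic K; case: (gfe) => m0 [m mp].
have [P [pB [pA [[ePB U] epB]]]] := adm_epi_pullback g gfe.
have gfm : g ∘ (f ∘ m) = 0 by rewrite compA (ses_kernel mp).1.
have [φ φE] := kernel_lift K gfm.
have [χ χE] : exists χ, κ ∘ χ = pB - f ∘ pA.
  by apply: (kernel_lift K); rewrite compDr compmN ePB compA subrr.
have mm : adm_mono m by exists z, (g ∘ f).
have [Y [i' [f' [[ePO V] mi]]]] := adm_mono_pushout φ mm.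
have [u [[ui uf] _]] := V _ κ f φE.
have [n0 [n np]] := epB.
have eB := ses_epic np.
have [v vE] : exists v, v ∘ pB = i' ∘ χ + f' ∘ pA.
  apply: (cokernel_desc (ses_cokernel np)).
  have pBn := (ses_kernel np).1.
  have [w wE] : exists w, m ∘ w = pA ∘ n.
    by apply: (kernel_lift (ses_kernel mp)); rewrite compA -ePB -compA pBn compm0.
  have -> : (i' ∘ χ + f' ∘ pA) ∘ n = i' ∘ (χ ∘ n) + f' ∘ (pA ∘ n).
    by rewrite compDl -!compA.
  have -> : χ ∘ n = - (φ ∘ w).
    apply: km; rewrite compA χE compmN compA φE -compA wE.
    by rewrite compDl pBn compNm -compA sub0r.
  by rewrite -wE compmN compA ePO -compA addNr.
have uv : u ∘ v = idm y.
  apply: eB; rewrite -compA vE compDr !compA ui uf χE comp1m.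
  by rewrite subrK.
have vu : v ∘ u = idm Y.
  have [//|w [_ Uw]] := V Y i' f'.
  rewrite -(Uw (v ∘ u)); first by apply: Uw; rewrite !comp1m.
  rewrite -!compA ui uf; split.
  - have [|s [[sB sA] _]] := U _ κ (0 : hom k x).
      by rewrite K.1 compm0.
    rewrite -sB compA vE compDl -!compA sA compm0 addr0.
    have -> : χ ∘ s = idm k.
      apply: km; rewrite compA χE compDl compNm -compA sA compm0 subr0.
      by rewrite sB compm1.
    by rewrite compm1.
  - have [|s [[sB sA] _]] := U _ f (idm x).
      by rewrite compm1.
    rewrite -sB compA vE compDl -!compA sA compm1.
    have -> : χ ∘ s = 0.
      apply: km; rewrite compA χE compDl compNm -compA sA compm1.
      by rewrite sB subrr compm0.
    by rewrite compm0 add0r.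
have km' : adm_mono κ.
  by rewrite -ui; apply: adm_mono_isol => //; exists v.
exists k, κ; apply: ses_of_mono => //; apply: cokernelI; first exact: K.1.
  move=> t a b e; apply: (ses_epic mp); by rewrite !compA e.
move=> t a aκ.
have [h hE] : exists h, h ∘ (g ∘ f) = a ∘ f.
  apply: (cokernel_desc (ses_cokernel mp)).
  by rewrite -compA -φE compA aκ comp0m.
exists h; apply: eB; rewrite -compA ePB compA hE.
have -> : pB = κ ∘ χ + f ∘ pA by rewrite χE subrK.
by rewrite compDr !compA aκ comp0m add0r.
Qed.

Lemma adm_mono_factor_coker x y z (f : hom x y) (g : hom y z) k (π : hom y k) :
  is_cokernel f π -> adm_mono (g ∘ f) -> adm_mono f.
Proof.
move=> K gfe; have km := cokernel_epic K; case: (gfe) => m0 [m mp].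
have [P [pB [pC [[ePB U] epB]]]] := adm_mono_pushout f gfe.
have gfm : m ∘ g ∘ f = 0 by rewrite -compA (ses_kernel mp).1.
have [φ φE] := cokernel_desc K gfm.
have [χ χE] : exists χ, χ ∘ π = pB - pC ∘ g.
  by apply: (cokernel_desc K); rewrite compDl compNm ePB -compA subrr.
have mm : adm_epi m by exists x, (g ∘ f).
have [Y [i' [f' [[ePO V] mi]]]] := adm_epi_pullback φ mm.
have [u [[ui uf] _]] := V _ π g φE.
have [n0 [n np]] := epB.
have eB := ses_monic np.
have [v vE] : exists v, pB ∘ v = χ ∘ i' + pC ∘ f'.
  apply: (kernel_lift (ses_kernel np)).
  have pBn := (ses_kernel np).1.
  have [w wE] : exists w, w ∘ m = n ∘ pC.
    by apply: (cokernel_desc (ses_cokernel mp)); rewrite -compA -ePB compA pBn comp0m.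
  have -> : n ∘ (χ ∘ i' + pC ∘ f') = n ∘ χ ∘ i' + n ∘ pC ∘ f'.
    by rewrite compDr !compA.
  have -> : n ∘ χ = - (w ∘ φ).
    apply: km; rewrite -compA χE compNm -compA φE compA wE.
    by rewrite compDr pBn compmN compA sub0r.
  by rewrite -wE compNm -compA ePO compA addNr.
have vu : v ∘ u = idm y.
  apply: eB; rewrite compA vE compDl -!compA ui uf χE compm1.
  by rewrite subrK.
have uv : u ∘ v = idm Y.
  have [//|w [_ Uw]] := V Y i' f'.
  rewrite -(Uw (u ∘ v)); first by apply: Uw; rewrite !compm1.
  rewrite !compA ui uf; split.
  - have [|s [[sB sA] _]] := U _ π (0 : hom z k).
      by rewrite K.1 comp0m.
    rewrite -sB -compA vE compDr !compA sA comp0m addr0.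
    have -> : s ∘ χ = idm k.
      apply: km; rewrite -compA χE compDr compmN compA sA comp0m subr0.
      by rewrite sB comp1m.
    by rewrite comp1m.
  - have [|s [[sB sA] _]] := U _ g (idm z).
      by rewrite comp1m.
    rewrite -sB -compA vE compDr !compA sA comp1m.
    have -> : s ∘ χ = 0.
      apply: km; rewrite -compA χE compDr compmN compA sA comp1m.
      by rewrite sB subrr comp0m.
    by rewrite comp0m add0r.
have km' : adm_epi π.
  rewrite -ui; apply: adm_epiM => //; apply: adm_epi_iso; exists v; split=> //.
exists k, π; apply: ses_of_epi => //; apply: kernelI; first exact: K.1.
  move=> t a b e; apply: (ses_monic mp); by rewrite -!compA e.
move=> t a aκ.
have [h hE] : exists h, g ∘ f ∘ h = g ∘ a.
  apply: (kernel_lift (ses_kernel mp)).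
  by rewrite compA -φE -compA aκ compm0.
exists h; apply: eB; rewrite compA ePB -compA hE.
have -> : pB = χ ∘ π + pC ∘ g by rewrite χE subrK.
by rewrite compDl -!compA aκ compm0 add0r.
Qed.

(** The cokernel of [f] is the kernel of the retraction of the coprojection
    onto [z] of the pushout of [g ∘ f] along [f]. *)
Lemma adm_mono_factor x y z (f : hom x y) (g : hom y z) :
  weakly_idempotent_complete A -> adm_mono (g ∘ f) -> adm_mono f.
Proof.
move=> wic gfe; have [P [pB [pC [[ePB U] _]]]] := adm_mono_pushout f gfe.
have [|r [[rB rC] _]] := U _ g (idm z); first by rewrite comp1m.
have [k [κ K]] := wic _ _ _ _ rC; have κm := kernel_monic K.
have [π πE] : exists π, κ ∘ π = pB - pC ∘ g.
  by apply: (kernel_lift K); rewrite compDr compmN compA rB rC comp1m subrr.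
have [ρ ρE] : exists ρ, κ ∘ ρ = idm P - pC ∘ r.
  by apply: (kernel_lift K); rewrite compDr compmN compA rC comp1m compm1 subrr.
have ρκ : ρ ∘ κ = idm k.
  by apply: κm; rewrite compA ρE compDl compNm -compA K.1 compm0 subr0 comp1m compm1.
have ρB : ρ ∘ pB = π.
  by apply: κm; rewrite compA ρE πE compDl compNm -compA rB comp1m.
have ρC : ρ ∘ pC = 0.
  by apply: κm; rewrite compA ρE compDl compNm -compA rC comp1m compm1 subrr compm0.
apply: (@adm_mono_factor_coker _ _ _ f g k π) => //; apply: cokernelI.
- by apply: κm; rewrite compA πE compDl compNm ePB -compA subrr compm0.
- move=> t a b e.
  have [|h [_ Uh]] := U t (a ∘ π) 0; first by rewrite -ρB -!compA ePB (compA ρ) ρC comp0m compm0 comp0m.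
  rewrite -[a]compm1 -[b]compm1 -ρκ !compA; congr (_ ∘ _).
  rewrite -(Uh (a ∘ ρ)); last by rewrite -!compA ρB ρC compm0.
  by apply: Uh; rewrite -!compA ρB ρC compm0 e.
- move=> t a af.
  have [|h [[hB hC] _]] := U t a 0; first by rewrite af comp0m.
  exists (h ∘ κ); by rewrite -compA πE compDr compmN compA hB hC comp0m subr0.
Qed.

End Exact.

(** * Sequential colimits *)

Definition seqcolim (C : category) (G : nat -> C)
    (g : forall i, hom (G i) (G i.+1)) (L : C) (c : forall i, hom (G i) L) :=
  (forall i, c i.+1 ∘ g i = c i) /\
  forall (T : C) (t : forall i, hom (G i) T), (forall i, t i.+1 ∘ g i = t i) ->
    exists! h : hom L T, forall i, h ∘ c i = t i.

Section SeqColim.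
Variables (C : category) (G : nat -> C) (g : forall i, hom (G i) (G i.+1)).
Variables (L : C) (c : forall i, hom (G i) L).
Hypothesis Lc : seqcolim g c.

Lemma seqcolim_ext (T : C) (a b : hom L T) :
  (forall i, a ∘ c i = b ∘ c i) -> a = b.
Proof.
move=> ab; have [|h [_ U]] := Lc.2 T (fun i => a ∘ c i).
  by move=> i; rewrite -compA Lc.1.
by rewrite -(U a) // -(U b).
Qed.

Lemma seqcolim_desc (T : C) (t : forall i, hom (G i) T) :
  (forall i, t i.+1 ∘ g i = t i) -> exists h, forall i, h ∘ c i = t i.
Proof. by move=> /(Lc.2 T t) [h [hE _]]; exists h. Qed.

Lemma seqcolimS : @seqcolim C (fun i => G i.+1) (fun i => g i.+1) L (fun i => c i.+1).
Proof.
split=> [i|T t tE]; first exact: Lc.1.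
pose t' i : hom (G i) T :=
  if i is j.+1 then t j else t 0%N ∘ g 0%N.
have [|h hE] := @seqcolim_desc T t'; first by case.
exists h; split=> [i|h' h'E]; first exact: (hE i.+1).
apply: seqcolim_ext => -[|i]; last by rewrite h'E (hE i.+1).
by rewrite -(Lc.1 0%N) !compA h'E (hE 1%N).
Qed.

End SeqColim.

Lemma seqcolimI (C : category) (G : nat -> C) (g : forall i, hom (G i) (G i.+1))
    (L : C) (c : forall i, hom (G i) L) :
  (forall i, c i.+1 ∘ g i = c i) ->
  (forall T (a b : hom L T), (forall i, a ∘ c i = b ∘ c i) -> a = b) ->
  (forall (T : C) (t : forall i, hom (G i) T), (forall i, t i.+1 ∘ g i = t i) ->
    exists h : hom L T, forall i, h ∘ c i = t i) -> seqcolim g c.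
Proof.
move=> cg ext desc; split=> // T t /desc [h hE]; exists h; split=> // h' h'E.
by apply: ext => i; rewrite hE h'E.
Qed.

Section Additive.
Variable A : additiveCat.

Lemma seqcolim_bimap (G G' : nat -> A) (g : forall i, hom (G i) (G i.+1))
    (g' : forall i, hom (G' i) (G' i.+1)) L c L' c' :
  @seqcolim A G g L c -> @seqcolim A G' g' L' c' ->
  @seqcolim A (fun i => G i ⊕ G' i) (fun i => bimap (g i) (g' i)) (L ⊕ L')
    (fun i => bimap (c i) (c' i)).
Proof.
move=> Lc Lc'; apply: seqcolimI => [i|T a b ab|T t tE].
- by rewrite bimap_comp Lc.1 Lc'.1.
- apply: bip_ext_from.
  + apply: (seqcolim_ext Lc) => i; rewrite -!compA -(bimap_inl _ (c' i)).
    by rewrite !compA ab.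
  + apply: (seqcolim_ext Lc') => i; rewrite -!compA -(bimap_inr (c i)).
    by rewrite !compA ab.
- have [|a aE] := seqcolim_desc Lc (t := fun i => t i ∘ inl_).
    by move=> i; rewrite -compA -(bimap_inl (g i) (g' i)) compA tE.
  have [|b bE] := seqcolim_desc Lc' (t := fun i => t i ∘ inr_).
    by move=> i; rewrite -compA -(bimap_inr (g i) (g' i)) compA tE.
  exists (copairm a b) => i; apply: bip_ext_from.
    by rewrite -compA bimap_inl compA copairm_inl aE.
  by rewrite -compA bimap_inr compA copairm_inr bE.
Qed.

Lemma seqcolim_unshift (G : nat -> A) (g : forall i, hom (G i) (G i.+1)) L c :
  is_zero (G 0%N) ->
  @seqcolim A (fun i => G i.+1) (fun i => g i.+1) L (fun i => c i.+1) ->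
  @seqcolim A G g L c.
Proof.
move=> z0 Lc; apply: seqcolimI => [[|i]|T a b ab|T t tE].
- exact: from_zero.
- exact: Lc.1.
- by apply: (seqcolim_ext Lc) => i.
- have [|h hE] := seqcolim_desc Lc (t := fun i => t i.+1) => [i|].
    exact: tE.
  exists h => -[|i]; [exact: from_zero|exact: hE].
Qed.

Section OmegaFunctor.
Variables (G : nat -> A) (g : forall i, hom (G i) (G i.+1)).

Definition transport_hom i j : hom (G i) (G j) :=
  if i =P j is ReflectT e then ecast k (hom (G i) (G k)) e (idm (G i)) else 0.

Fixpoint transition i j : hom (G i) (G j) :=
  match j with
  | 0 => transport_hom i 0
  | j'.+1 => if (i <= j')%N then g j' ∘ transition i j' else transport_hom i j'.+1
  end.

Lemma transition_id i : transition i i = idm (G i).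
Proof.
have tr1 : transport_hom i i = idm (G i).
  by rewrite /transport_hom; case: eqP => // e; rewrite (eq_axiomK e).
by case: i tr1 => [|i] //= ->; rewrite ltnn.
Qed.

Lemma transitionS i j : (i <= j)%N -> transition i j.+1 = g j ∘ transition i j.
Proof. by move=> /= ->. Qed.

Lemma transition_comp i j k : (i <= j)%N -> (j <= k)%N ->
  transition i k = transition j k ∘ transition i j.
Proof.
move=> ij; elim: k => [|k IH].
  by rewrite leqn0 => /eqP j0; subst j; rewrite transition_id comp1m.
rewrite leq_eqVlt => /predU1P[e|jk]; first by subst j; rewrite transition_id comp1m.
by rewrite !transitionS ?IH ?compA // (leq_trans ij).
Qed.

Definition omega_functor : functor omega A.
Proof.
refine (@Functor omega A G (fun i j _ => transition i j) _ _).
- by move=> i; apply: transition_id.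
- by move=> i j k jk ij; apply: transition_comp.
Defined.

Lemma omega_colimit L (c : forall i, hom (G i) L) :
  is_colimit (J := omega) (G := omega_functor) c <-> seqcolim g c.
Proof.
have cocone T (t : forall i, hom (G i) T) : (forall i, t i.+1 ∘ g i = t i) ->
    forall (i j : omega) (u : hom i j), t j ∘ fmap omega_functor u = t i.
  move=> tE i j /= ij; rewrite -(subnK ij); elim: (j - i)%N => [|k IH].
    by rewrite transition_id compm1.
  by rewrite addSn transitionS ?leq_addl // compA tE IH.
have cocone' T (t : forall i, hom (G i) T) :
    (forall (i j : omega) (u : hom i j), t j ∘ fmap omega_functor u = t i) ->
    forall i, t i.+1 ∘ g i = t i.
  move=> tE i; have /= := tE i i.+1 (leqnSn i).
  by rewrite leqnn transition_id compm1.
split=> -[cE U]; split.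
- exact: cocone'.
- by move=> T t /cocone tE; apply: U.
- exact: cocone.
- by move=> T t tE; apply: U; apply: cocone'.
Qed.

End OmegaFunctor.

End Additive.

Section Exact.
Variable A : exactCat.
Implicit Types G : nat -> A.

Lemma omega_functor_adm_mono G (g : forall i, hom (G i) (G i.+1)) :
  (forall i, adm_mono (g i)) -> fun_adm_mono (omega_functor g).
Proof.
move=> gm i j /= ij; rewrite -(subnK ij); elim: (j - i)%N => [|k IH].
  by rewrite transition_id; apply: adm_mono1.
by rewrite addSn transitionS ?leq_addl //; apply: adm_monoM; [exact: gm|exact: IH].
Qed.

Lemma seqcolim_exists : weakly_omega_elementary A ->
  forall G (g : forall i, hom (G i) (G i.+1)), (forall i, adm_mono (g i)) ->
  exists L c, @seqcolim A G g L c.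
Proof.
move=> [ex _] G g /omega_functor_adm_mono /ex [L [c Lc]].
by exists L, c; apply/omega_colimit.
Qed.

Lemma seqcolim_ses : weakly_omega_elementary A ->
  forall G' G G'' g' g g'' (al : forall i, hom (G' i) (G i))
    (be : forall i, hom (G i) (G'' i)),
  (forall i, al i.+1 ∘ g' i = g i ∘ al i) ->
  (forall i, be i.+1 ∘ g i = g'' i ∘ be i) ->
  (forall i, adm_mono (g' i)) -> (forall i, adm_mono (g i)) ->
  (forall i, adm_mono (g'' i)) -> (forall i, ses (al i) (be i)) ->
  forall L' c' L c L'' c'',
  @seqcolim A G' g' L' c' -> @seqcolim A G g L c -> @seqcolim A G'' g'' L'' c'' ->
  forall (a : hom L' L) (b : hom L L''),
  (forall i, a ∘ c' i = c i ∘ al i) -> (forall i, b ∘ c i = c'' i ∘ be i) ->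
  ses a b.
Proof.
move=> [_ ex] G' G G'' g' g g'' al be alE beE m' m m'' S.
move=> L' c' L c L'' c'' /omega_colimit C' /omega_colimit C /omega_colimit C'' a b aE bE.
have nat H H' h h' (t : forall i, hom (H i) (H' i)) :
    (forall i, t i.+1 ∘ h i = h' i ∘ t i) ->
    forall (i j : omega) (u : hom i j),
    t j ∘ fmap (@omega_functor A H h) u = fmap (@omega_functor A H' h') u ∘ t i.
  move=> tE i j /= ij; rewrite -(subnK ij); elim: (j - i)%N => [|k IH].
    by rewrite !transition_id compm1 comp1m.
  by rewrite addSn !transitionS ?leq_addl // compA tE -!compA IH.
pose A1 := @NatTrans omega A (omega_functor g') (omega_functor g) al (nat _ _ _ _ _ alE).
pose B1 := @NatTrans omega A (omega_functor g) (omega_functor g'') be (nat _ _ _ _ _ beE).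
by apply: (ex _ _ _ A1 B1 (omega_functor_adm_mono m') (omega_functor_adm_mono m)
  (omega_functor_adm_mono m'') S _ _ _ _ _ _ C' C C'').
Qed.

End Exact.

(** * Staged objects *)

(** A staged object is a sequence of complexes, the [k]-th of which vanishes in
    degrees at most [- k]: its term of degree [n] is [so (n + k) n]. With this
    indexing the differential lowers the stage, so that the resolution below is
    a structural recursion on the stage, for all degrees at once. *)
Record staged (A : additiveCat) := Staged {
  so :> nat -> int -> A;
  sι : forall s n, hom (so s n) (so s.+1 n);
  sd : forall s n, hom (so s.+1 n) (so s (n - 1));
  so0 : forall n, is_zero (so 0%N n);
  sdd : forall s n, sd s (n - 1) ∘ sd s.+1 n = 0;
  sιd : forall s n, sι s (n - 1) ∘ sd s n = sd s.+1 n ∘ sι s.+1 n }.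
Arguments sι {A} _ s n.
Arguments sd {A} _ s n.
Arguments so0 {A} _ n.

Record smap (A : additiveCat) (X Y : staged A) := SMap {
  sm :> forall s n, hom (X s n) (Y s n);
  sm_ι : forall s n, sm s.+1 n ∘ sι X s n = sι Y s n ∘ sm s n;
  sm_d : forall s n, sm s (n - 1) ∘ sd X s n = sd Y s n ∘ sm s.+1 n }.

Record scocone (A : additiveCat) (X : staged A) (T : complex A) := SCocone {
  sc :> forall s n, hom (X s n) (T n);
  sc_ι : forall s n, sc s.+1 n ∘ sι X s n = sc s n;
  sc_d : forall s n, cd T n ∘ sc s.+1 n = sc s (n - 1) ∘ sd X s n }.

Definition is_scolim (A : additiveCat) (X : staged A) (T : complex A)
    (c : scocone X T) : Prop :=
  forall n, seqcolim (fun s => sι X s n) (fun s => c s n).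

Section Cone.
Variable A : additiveCat.

Lemma cone_dE (X Y : complex A) (f : chain_map X Y) n :
  cd (cone f) n = pairm (copairm (cd Y n) (f (n - 1))) (- (cd X (n - 1) ∘ prr)).
Proof. by rewrite /= /cone_d /pairm /copairm compmN. Qed.

Variables (X Y : staged A) (f : smap X Y).

Definition scone_ob s n : A :=
  if s is s'.+1 then Y s'.+1 n ⊕ X s' (n - 1) else zob.

Definition scone_ι s n : hom (scone_ob s n) (scone_ob s.+1 n) :=
  match s with
  | 0 => 0
  | s'.+1 => bimap (sι Y s'.+1 n) (sι X s' (n - 1))
  end.

Definition scone_d s n : hom (scone_ob s.+1 n) (scone_ob s (n - 1)) :=
  match s with
  | 0 => 0
  | s'.+1 => pairm (copairm (sd Y s'.+1 n) (f s'.+1 (n - 1)))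
                   (- (sd X s' (n - 1) ∘ prr))
  end.

Lemma scone_dd s n : scone_d s (n - 1) ∘ scone_d s.+1 n = 0.
Proof.
case: s => [|s] /=; first by rewrite comp0m.
apply: bip_ext_to; rewrite compm0 compA ?prl_pairm ?prr_pairm.
- rewrite copairm_pairm comp_copairm sdd compmN compA sm_d.
  by rewrite /copairm comp0m add0r subrr.
- by rewrite compNm -compA prr_pairm compmN opprK compA sdd comp0m.
Qed.

Lemma scone_ιd s n :
  scone_ι s (n - 1) ∘ scone_d s n = scone_d s.+1 n ∘ scone_ι s.+1 n.
Proof.
case: s => [|s] /=; last first.
  apply: bip_ext_to; rewrite !compA ?prl_bimap ?prr_bimap ?prl_pairm ?prr_pairm.
  - rewrite -compA prl_pairm /copairm compDl compDr !compA sιd -!compA.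
    by rewrite prl_bimap prr_bimap !compA sm_ι.
  - rewrite -compA prr_pairm compmN compNm -compA prr_bimap !compA sιd //.
rewrite comp0m; apply: bip_ext_to; rewrite compm0 compA ?prl_pairm ?prr_pairm.
- rewrite /copairm compDl -!compA prl_bimap prr_bimap !compA -sιd.
  rewrite (to_zero (sd Y 0%N n) 0 (so0 Y _)) compm0 comp0m add0r.
  by rewrite (from_zero (_ ∘ sι X _ _) 0 (so0 X _)) comp0m.
- by rewrite (to_zero (sd X 0%N _) 0 (so0 X _)) comp0m oppr0 comp0m.
Qed.

Definition scone : staged A :=
  @Staged A scone_ob scone_ι scone_d (fun n => zob_zero A) scone_dd scone_ιd.

Variables (T T' : complex A) (φ : chain_map T T').
Variables (c : scocone X T) (c' : scocone Y T').
Hypothesis φc : forall s n, φ n ∘ c s n = c' s n ∘ f s n.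

Definition scone_cocone : scocone scone (cone φ).
Proof.
pose k s n : hom (scone s n) (cone φ n) :=
  match s return hom (scone s n) (cone φ n) with
  | 0 => 0
  | s'.+1 => bimap (c' s'.+1 n) (c s' (n - 1))
  end.
refine (@SCocone A scone (cone φ) k _ _).
- move=> [|s] n /=; first by rewrite compm0.
  by rewrite bimap_comp !sc_ι.
- move=> [|s] n; rewrite cone_dE /=.
    rewrite comp0m; apply: bip_ext_to; rewrite compm0 compA ?prl_pairm ?prr_pairm.
      rewrite /copairm compDl -!compA prl_bimap prr_bimap !compA sc_d φc.
      rewrite (to_zero (sd Y 0%N n) 0 (so0 Y _)) compm0 comp0m add0r.
      by rewrite (from_zero (c' _ _ ∘ _) 0 (so0 X _)) comp0m.
    rewrite compNm -compA prr_bimap compA (from_zero (_ ∘ c 0%N _) 0 (so0 X _)).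
    by rewrite comp0m oppr0.
  apply: bip_ext_to; rewrite !compA ?prl_bimap ?prr_bimap ?prl_pairm ?prr_pairm.
    rewrite -(compA (c' s.+1 (n - 1))) prl_pairm /copairm compDl compDr !compA.
    by rewrite -!compA prl_bimap prr_bimap !compA sc_d φc.
  rewrite -(compA (c s _)) prr_pairm compmN compNm -compA prr_bimap !compA.
  by rewrite sc_d.
Defined.

Lemma scone_scolim : is_scolim c -> is_scolim c' -> is_scolim scone_cocone.
Proof.
move=> C C' n; apply: seqcolim_unshift; first exact: zob_zero.
apply: (@seqcolim_bimap A _ _ _ _ _ _ _ _ (seqcolimS (C' n)) (C (n - 1))).
Qed.

End Cone.

Definition staged_map (A B : additiveCat) (F : additiveFunctor A B)
  (X : staged A) : staged B.
Proof.
refine (@Staged B (fun s n => F (X s n)) (fun s n => fmap F (sι X s n))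
  (fun s n => fmap F (sd X s n)) _ _ _).
- by move=> n; rewrite /is_zero -fmap1 (so0 X n) fmap0.
- by move=> s n; rewrite -fmapM sdd fmap0.
- by move=> s n; rewrite -!fmapM sιd.
Defined.

Definition scocone_map (A B : additiveCat) (F : additiveFunctor A B)
  (X : staged A) (T : complex A) (c : scocone X T) :
  scocone (staged_map F X) (cx_map F T).
Proof.
refine (@SCocone B (staged_map F X) (cx_map F T) (fun s n => fmap F (c s n)) _ _).
- by move=> s n; rewrite /= -fmapM sc_ι.
- by move=> s n; rewrite /= -!fmapM sc_d.
Defined.

Definition sexact (A : exactCat) (B : staged A) : Prop :=
  exists (Z : nat -> int -> A) (i : forall s n, hom (Z s n) (B s n))
         (p : forall s n, hom (B s.+1 n) (Z s (n - 1))),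
    (forall n, is_zero (Z 0%N n)) /\
    forall s n, sd B s n = i s (n - 1) ∘ p s n /\ ses (i s.+1 n) (p s n).

Section ExactColimit.
Variable A : exactCat.
Hypothesis wic : weakly_idempotent_complete A.
Hypothesis elem : weakly_omega_elementary A.

(** The cycles form sequences of admissible monomorphisms, because a
    composite of [Z s n -> Z s.+1 n] is the admissible monomorphism
    [Z s n -> B s n -> B s.+1 n]. *)
Lemma acyclic_scolim (B : staged A) (T : complex A) (c : scocone B T) :
  (forall s n, adm_mono (sι B s.+2 n)) -> is_scolim c -> sexact B -> acyclic T.
Proof.
move=> ιm C [Z [i [p [Z0 H]]]].
have dE s n : sd B s n = i s (n - 1) ∘ p s n by case: (H s n).
have S s n : ses (i s.+1 n) (p s n) by case: (H s n).
have im s n : monic (i s n).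
  case: s => [|s]; last exact: ses_monic (S s n).
  by move=> t g h _; apply: to_zero.
have pi s n : p s n ∘ i s.+1 n = 0 := (ses_kernel (S s n)).1.
have ζP s n : exists ζ, i s.+2 n ∘ ζ = sι B s.+1 n ∘ i s.+1 n.
  apply: (kernel_lift (ses_kernel (S _ _))); apply: im.
  by rewrite compA compA -dE -sιd dE compm0 -!compA pi !compm0.
pose ζ s n := sval (cid (ζP s n)).
have ζE s n : i s.+2 n ∘ ζ s n = sι B s.+1 n ∘ i s.+1 n by rewrite /ζ; case: cid.
have ζp s n : p s.+2 n ∘ sι B s.+2 n = ζ s (n - 1) ∘ p s.+1 n.
  by apply: im; rewrite !compA ζE -dE -sιd dE compA.
have ζm s n : adm_mono (ζ s.+1 n).
  apply: (adm_mono_factor (g := i s.+3 n) wic); rewrite ζE; apply: adm_monoM.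
    exact: ιm.
  by exists (Z s.+1 (n - 1)), (p s.+1 n); apply: S.
pose GZ n s := Z s.+2 n.
have CP n : exists L : {L : A & forall s, hom (GZ n s) L},
    seqcolim (fun s => ζ s.+1 n) (projT2 L).
  have [L [k Lk]] := seqcolim_exists elem (fun s => ζm s n).
  by exists (existT _ L k).
pose ZT n := projT1 (sval (cid (CP n))).
pose z n : forall s, hom (GZ n s) (ZT n) := projT2 (sval (cid (CP n))).
have ZC n : seqcolim (fun s => ζ s.+1 n) (z n) by rewrite /z /ZT; case: cid.
have aP n : exists a, forall s, a ∘ z n s = c s.+2 n ∘ i s.+2 n.
  apply: (seqcolim_desc (ZC n)) => s.
  by rewrite -compA ζE compA sc_ι.
pose a n := sval (cid (aP n)).
have aE n s : a n ∘ z n s = c s.+2 n ∘ i s.+2 n by rewrite /a; case: cid.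
have C3 n := seqcolimS (seqcolimS (seqcolimS (C n))).
have bP n : exists b, forall s, b ∘ c s.+3 n = z (n - 1) s ∘ p s.+2 n.
  apply: (seqcolim_desc (C3 n)) => s.
  by rewrite -compA ζp compA (ZC _).1.
pose b n := sval (cid (bP n)).
have bE n s : b n ∘ c s.+3 n = z (n - 1) s ∘ p s.+2 n by rewrite /b; case: cid.
exists ZT, a, b => n; split.
  apply: (seqcolim_ext (C3 n)) => s.
  by rewrite -compA bE compA aE sc_d dE compA.
apply: (@seqcolim_ses A elem _ _ _ _ _ _ (fun s => i s.+3 n) (fun s => p s.+2 n)
  _ _ _ _ _ _ _ _ _ _ _ _ (seqcolimS (ZC n)) (C3 n) (ZC (n - 1))) => s.
- exact: ζE.
- exact: ζp.
- exact: ζm.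
- exact: ιm.
- exact: ζm.
- exact: S.
- exact: aE.
- exact: bE.
Qed.

End ExactColimit.

Lemma acyclic_iso (A : exactCat) (X Y : complex A) (b : chain_map X Y) :
  (forall n, is_iso (b n)) -> acyclic X -> acyclic Y.
Proof.
move=> bi [Z [i [p H]]].
pose v n := sval (cid (bi n)).
have [vb bv] : (forall n, v n ∘ b n = idm _) /\ (forall n, b n ∘ v n = idm _).
  by split=> n; rewrite /v; case: cid => g [].
exists Z, (fun n => b n ∘ i n), (fun n => p n ∘ v n) => n.
have [dE S] := H n; split.
  by rewrite -(compm1 (cd Y n)) -bv compA cmP dE !compA.
apply: (ses_iso (is_iso1 _) (bi n) (is_iso1 _) _ _ S); first by rewrite compm1.
by rewrite -compA vb compm1 comp1m.
Qed.

Section AdditiveFunctor.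
Variables (A B : additiveCat) (F : additiveFunctor A B).

Lemma biproduct_fmap x y z i j r p : @biproduct_of A x y z i j r p ->
  biproduct_of (fmap F i) (fmap F j) (fmap F r) (fmap F p).
Proof.
move=> [e1 e2 e3 e4 e5]; split.
all: by rewrite -!fmapM -?fmapD ?e1 ?e2 ?e3 ?e4 ?e5 ?fmap0 ?fmap1.
Qed.

End AdditiveFunctor.

Lemma acyclic_cone_map (A B : exactCat) (F : additiveFunctor A B)
    (X Y : complex A) (f : chain_map X Y) :
  acyclic (cx_map F (cone f)) -> acyclic (cone (fmap (ChF F) f)).
Proof.
pose b n : hom (cx_map F (cone f) n) (cone (fmap (ChF F) f) n) :=
  pairm (fmap F prl) (fmap F prr).
have bP n : cd (cone (fmap (ChF F) f)) n ∘ b n = b (n - 1) ∘ cd (cx_map F (cone f)) n.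
  have -> : cd (cx_map F (cone f)) n = fmap F (cd (cone f) n) by [].
  rewrite !cone_dE; apply: bip_ext_to; rewrite !compA ?prl_pairm ?prr_pairm.
  - by rewrite copairm_pairm -!fmapM -fmapD prl_pairm.
  - rewrite compNm -compA prr_pairm -!fmapM prr_pairm.
    apply/esym/eqP; rewrite -subr_eq0 opprK -fmapD addNr; apply/eqP; exact: fmap0.
apply: (acyclic_iso (b := ChainMap bP)) => n /=.
exists (copairm (fmap F inl_) (fmap F inr_)); split.
- by rewrite copairm_pairm -!fmapM -fmapD bip_id fmap1.
- apply: bip_ext_to; rewrite compm1 compA ?prl_pairm ?prr_pairm comp_copairm.
  + by rewrite -!fmapM prl_inl prl_inr fmap1 fmap0 /copairm comp0m comp1m addr0.
  + by rewrite -!fmapM prr_inl prr_inr fmap1 fmap0 /copairm comp0m comp1m add0r.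
Qed.

Record split_mono (A : additiveCat) (S : A -> Prop) (x y : A) (i : hom x y) :=
  SplitMono {
  split_ob : A;
  split_j : hom split_ob y;
  split_r : hom y x;
  split_p : hom y split_ob;
  split_S : S split_ob;
  split_bip : biproduct_of i split_j split_r split_p }.
Arguments split_ob {A S x y i} _.
Arguments split_j {A S x y i} _.
Arguments split_r {A S x y i} _.
Arguments split_p {A S x y i} _.

Definition stage_split (A : additiveCat) (S : A -> Prop) (X : staged A) : Type :=
  forall s n, split_mono S (sι X s n).

Section PreservesSeqcolim.
Variables (A B : exactCat) (F : additiveFunctor A B) (S : A -> Prop).
Hypothesis pres : preserves_countable_coproducts F S.

Lemma preserves_seqcolim (G : nat -> A) (g : forall i, hom (G i) (G i.+1)) L c :
  is_zero (G 0%N) -> (forall i, split_mono S (g i)) -> @seqcolim A G g L c ->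
  @seqcolim B (fun i => F (G i)) (fun i => fmap F (g i)) (F L)
    (fun i => fmap F (c i)).
Proof.
move=> z0 sp Lc.
pose N i := split_ob (sp i).
pose j i : hom (N i) (G i.+1) := split_j (sp i).
have cop : is_coproduct (fun i => c i.+1 ∘ j i).
  move=> T t.
  pose k := fix k i : hom (G i) T :=
    if i is i'.+1 then k i' ∘ split_r (sp i') + t i' ∘ split_p (sp i') else 0.
  have kg i : k i.+1 ∘ g i = k i.
    have [rg _ _ pg _] := split_bip (sp i).
    by rewrite /= compDl -!compA rg pg compm0 compm1 addr0.
  have kj i : k i.+1 ∘ j i = t i.
    have [_ pj rj _ _] := split_bip (sp i).
    by rewrite /= compDl -!compA rj pj compm0 compm1 add0r.
  have [h hE] := seqcolim_desc Lc kg.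
  exists h; split=> [i|h' h'E]; first by rewrite compA hE kj.
  apply: (seqcolim_ext Lc); elim=> [|i IH]; first exact: from_zero.
  apply: (biproduct_ext (split_bip (sp i))); rewrite -!compA.
    by rewrite !Lc.1.
  by rewrite h'E compA hE kj.
have cop' := pres (I := nat) (fun i => split_S (sp i)) cop.
apply: seqcolimI => [i|T a b ab|T t tE].
- by rewrite -fmapM Lc.1.
- have [h [_ U]] := cop' T (fun i => a ∘ fmap F (c i.+1 ∘ j i)).
  by rewrite -(U a) // -(U b) // => i; rewrite fmapM !compA ab.
- have [h [hE _]] := cop' T (fun i => t i.+1 ∘ fmap F (j i)).
  exists h; elim=> [|i IH].
    by apply: from_zero; rewrite /is_zero -fmap1 z0 fmap0.
  apply: (biproduct_ext (biproduct_fmap F (split_bip (sp i)))).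
    by rewrite -compA -fmapM Lc.1 IH tE.
  by rewrite -compA -fmapM hE.
Qed.

End PreservesSeqcolim.

Section FProjective.
Variables (D E : exactCat) (F : additiveFunctor D E) (S : D -> Prop).
Hypothesis wicE : weakly_idempotent_complete E.
Hypothesis elemE : weakly_omega_elementary E.
Hypothesis proj : projective_subcat F S.
Hypothesis pres : preserves_countable_coproducts F S.

Lemma projective_zero x : is_zero x -> S x.
Proof.
move=> x0; have [] // := proj_ses proj (ses_0id zob x0); exact: proj_zob proj.
Qed.

Lemma acyclic_map_scolim (B : staged D) (T : complex D) (c : scocone B T) :
  (forall s n, S (B s n)) -> stage_split S B -> is_scolim c -> sexact B ->
  acyclic (cx_map F T).
Proof.
move=> SB sp C [Z [i [p [Z0 H]]]].
have SZ s n : S (Z s n).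
  elim: s n => [|s IH] n; first exact/projective_zero/Z0.
  by case: (proj_ses proj (H s n).2 (SB _ _) (IH _)).
apply: (@acyclic_scolim E wicE elemE (staged_map F B) _ (scocone_map F c)).
- move=> s n; exact: adm_mono_biproduct (biproduct_fmap F (split_bip (sp _ _))).
- move=> n; apply: (preserves_seqcolim pres (so0 B n) (fun s => sp s n) (C n)).
- exists (fun s n => F (Z s n)), (fun s n => fmap F (i s n)),
    (fun s n => fmap F (p s n)); split.
    by move=> n; rewrite /is_zero -fmap1 Z0 fmap0.
  move=> s n; have [dE Sip] := H s n; split; first by rewrite /= dE fmapM.
  by case: (proj_ses proj Sip (SB _ _) (SZ _ _)).
Qed.

End FProjective.

Lemma stage_split_scone (A : additiveCat) (S : A -> Prop)
    (SD : forall x y, S x -> S y -> S (x ⊕ y)) (X Y : staged A) (f : smap X Y) :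
  (forall s n, S (X s n)) -> (forall s n, S (Y s n)) ->
  stage_split S X -> stage_split S Y -> stage_split S (scone f).
Proof.
move=> SX SY spX spY [|s] n; last first.
  exact: SplitMono (SD _ _ (split_S _) (split_S _))
    (biproduct_bimap (split_bip (spY s.+1 n)) (split_bip (spX s (n - 1)))).
apply: (@SplitMono _ _ _ _ _ (scone f 1%N n) (idm _) 0 (idm _)
  (SD _ _ (SY _ _) (SX _ _))).
split; rewrite ?comp0m ?compm0 ?comp1m ?add0r //.
exact/esym/zob_zero.
Qed.

(** Exactness in terms of generalized elements, after refinement along
    admissible epimorphisms. *)
Definition slocal (A : exactCat) (B : staged A) : Prop :=
  forall s n t (b : hom t (B s.+1 (n - 1))), sd B s (n - 1) ∘ b = 0 ->
  exists (t' : A) (e : hom t' t) (b' : hom t' (B s.+2 n)),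
    adm_epi e /\ sd B s.+1 n ∘ b' = b ∘ e.

Lemma acyclic_local (A : exactCat) (X : complex A) : acyclic X ->
  forall n t (b : hom t (X (n - 1))), cd X (n - 1) ∘ b = 0 ->
  exists (t' : A) (e : hom t' t) (b' : hom t' (X n)),
    adm_epi e /\ cd X n ∘ b' = b ∘ e.
Proof.
move=> [Z [i [p H]]] n t b db0.
have [d1 S1] := H (n - 1); have [dn Sn] := H n.
have [a ai] : exists a, i (n - 1) ∘ a = b.
  apply: (kernel_lift (ses_kernel S1)); apply: (ses_monic (H (n - 1 - 1)).2).
  by rewrite compA -d1 db0 compm0.
have [|t' [e [b' [[eE _] ee]]]] := adm_epi_pullback a (_ : adm_epi (p n)).
  by exists (Z n), (i n).
by exists t', e, b'; split=> //; rewrite dn -compA -eE compA ai.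
Qed.

Section Kernels.
Variable D : exactCat.
Hypothesis hk : has_kernels D.

Definition kob (x y : D) (p : hom x y) : D := sval (cid (hk p)).
Definition kar (x y : D) (p : hom x y) : hom (kob p) x :=
  sval (cid (svalP (cid (hk p)))).
Lemma karP (x y : D) (p : hom x y) : is_kernel (kar p) p.
Proof. exact: svalP (cid (svalP (cid (hk p)))). Qed.
Lemma kar_monic (x y : D) (p : hom x y) : monic (kar p).
Proof. exact: kernel_monic (karP p). Qed.

Definition divm (k x t : D) (i : hom k x) (f : hom t x) : hom t k :=
  if pselect (exists g, i ∘ g = f) is left H then sval (cid H) else 0.

Lemma divmK (k x t : D) (i : hom k x) (f : hom t x) :
  (exists g, i ∘ g = f) -> i ∘ divm i f = f.
Proof. by rewrite /divm; case: pselect => // H _; case: cid. Qed.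

Lemma kar_divm (x y t : D) (p : hom x y) (f : hom t x) :
  p ∘ f = 0 -> kar p ∘ divm (kar p) f = f.
Proof. by move=> pf; apply/divmK/(kernel_lift (karP p)). Qed.

Lemma adm_epi_local (x y t : D) (p : hom x y) (u : hom t x) :
  adm_epi (p ∘ u) -> adm_epi p.
Proof. exact/adm_epi_factor/karP. Qed.

Lemma slocal_sexact (B : staged D) : slocal B -> sexact B.
Proof.
move=> loc.
pose Z s n := if s is s'.+1 then kob (sd B s' n) else zob.
pose i s n : hom (Z s n) (B s n) :=
  match s return hom (Z s n) (B s n) with
  | 0 => 0 | s'.+1 => kar (sd B s' n) end.
pose p s n : hom (B s.+1 n) (Z s (n - 1)) :=
  match s return hom (B s.+1 n) (Z s (n - 1)) with
  | 0 => 0 | s'.+1 => divm (kar (sd B s' (n - 1))) (sd B s'.+1 n) end.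
have ip s n : sd B s n = i s (n - 1) ∘ p s n.
  case: s => [|s] /=; first exact: to_zero (so0 _ _).
  by rewrite kar_divm // sdd.
have im s n : monic (i s n).
  case: s => [|s]; last exact: kar_monic.
  by move=> t g h _; apply: to_zero; apply: zob_zero.
exists Z, i, p; split; first by move=> n; apply: zob_zero.
move=> s n; split=> //; apply: ses_of_epi; last first.
  have [e U] := karP (sd B s n); split.
    by apply: im; rewrite compA -ip e compm0.
  by move=> t f pf; apply: U; rewrite ip -compA pf compm0.
case: s => [|s].
  by exists (B 1%N n), (idm _); apply/ses_id0/zob_zero.
have [t' [e [b' [ee eE]]]] := loc s n _ _ (karP (sd B s (n - 1))).1.
apply: (adm_epi_local (u := b')).
suff -> : p s.+1 n ∘ b' = e by [].
by apply: (im s.+1); rewrite compA -ip eE.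
Qed.

Definition sd_pred (X : staged D) s n : hom (X s n) (X s.-1 (n - 1)) :=
  match s return hom (X s n) (X s.-1 (n - 1)) with
  | 0 => 0 | s'.+1 => sd X s' n end.

Lemma sd_pred_smap (X Y : staged D) (f : smap X Y) s n :
  f s.-1 (n - 1) ∘ sd_pred X s n = sd_pred Y s n ∘ f s n.
Proof. by case: s => [|s] /=; [rewrite compm0 comp0m | exact: sm_d]. Qed.

(** The cone of [f] satisfies [slocal], spelled out on the two components. *)
Definition local_qis (X Y : staged D) (f : smap X Y) : Prop :=
  forall s n t (y : hom t (Y s.+1 (n - 1))) (x : hom t (X s (n - 1 - 1))),
  sd Y s (n - 1) ∘ y + f s (n - 1 - 1) ∘ x = 0 ->
  sd_pred X s (n - 1 - 1) ∘ x = 0 ->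
  exists (t' : D) (e : hom t' t) (y' : hom t' (Y s.+2 n))
    (x' : hom t' (X s.+1 (n - 1))),
  [/\ adm_epi e, sd Y s.+1 n ∘ y' + f s.+1 (n - 1) ∘ x' = y ∘ e
    & sd X s (n - 1) ∘ x' = - (x ∘ e)].

Lemma local_qis_slocal (X Y : staged D) (f : smap X Y) :
  local_qis f -> slocal (scone f).
Proof.
move=> loc s n t b db0.
have [||t' [e [y' [x' [ee yE xE]]]]] := loc s n t (prl ∘ b) (prr ∘ b).
- case: s b db0 => [|s] b db0; first exact: to_zero (so0 _ _).
  have := congr1 (comp prl) db0.
  by rewrite (compA prl) /= prl_pairm compm0 compDl -!compA.
- case: s b db0 => [|s] b db0; first exact: comp0m.
  have := congr1 (comp prr) db0.
  by rewrite (compA prr) /= prr_pairm compm0 compNm -compA => /eqP; rewrite oppr_eq0 => /eqP.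
exists t', e, (pairm y' x'); split=> //.
apply: bip_ext_to; rewrite /= compA ?prl_pairm ?prr_pairm.
  by rewrite copairm_pairm yE compA.
by rewrite compNm -compA prr_pairm xE opprK compA.
Qed.

Lemma local_qis_cancel (X X' Y Y' : staged D) (f : smap X X') (h : smap Y Y')
    (q : smap X Y) (q' : smap X' Y') :
  (forall s n, q' s n ∘ f s n = h s n ∘ q s n) ->
  local_qis q -> local_qis q' -> local_qis h -> local_qis f.
Proof.
move=> comm Lq Lq' Lh s n; have [m ->] : exists m, n = m - 1.
  by exists (n + 1); rewrite addrK.
move=> {n} t r' r e1 e2.
have [||t1 [c1 [y' [y [ec1 E1 E1']]]]] := Lh s (m - 1) t (q' _ _ ∘ r') (q _ _ ∘ r).
- by rewrite !compA -sm_d -comm -!compA -compDr e1 compm0.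
- by rewrite compA -sd_pred_smap -compA e2 compm0.
have [||t2 [c2 [y1 [r1 [ec2 E2 E2']]]]] := Lq s (m - 1) t1 y (r ∘ c1).
- by rewrite E1' compA addNr.
- by rewrite compA e2 comp0m.
have [||t3 [c3 [u' [v' [ec3 E3 E3']]]]] :=
  Lq' s.+1 m t2 (y' ∘ c2 + h _ _ ∘ y1) (- (r' ∘ c1 ∘ c2 - f _ _ ∘ r1)).
- have A1 : sd Y' s.+1 (m - 1) ∘ (h s.+2 (m - 1) ∘ y1) =
      h s.+1 (m - 1 - 1) ∘ (y ∘ c2 - q s.+1 (m - 1 - 1) ∘ r1).
    by rewrite compA -sm_d -E2 addrK compA.
  have A2 : q' s.+1 (m - 1 - 1) ∘ (r' ∘ c1 ∘ c2) =
      sd Y' s.+1 (m - 1) ∘ (y' ∘ c2) + h s.+1 (m - 1 - 1) ∘ (y ∘ c2).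
    by rewrite !compA -compDl E1.
  have A3 : q' s.+1 (m - 1 - 1) ∘ (f s.+1 (m - 1 - 1) ∘ r1) =
      h s.+1 (m - 1 - 1) ∘ (q s.+1 (m - 1 - 1) ∘ r1).
    by rewrite compA comm compA.
  by rewrite compDr A1 compmN (compDr (q' _ _)) compmN A2 A3 compDr compmN addrA subrr.
- rewrite compmN compDr compmN !compA /= -sm_d -!compA E2'.
  rewrite compmN opprK !compA -!compDl.
  by rewrite e1 !comp0m oppr0.
exists t3, (c1 ∘ c2 ∘ c3), v', (r1 ∘ c3); split.
- by apply: adm_epiM => //; apply: adm_epiM.
- by rewrite E3' compNm opprK compDl compNm !compA subrK.
- by rewrite compA E2' compNm !compA.
Qed.

End Kernels.

(** * Good truncations *)

Section Truncation.
Variable D : exactCat.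
Hypothesis hk : has_kernels D.
Local Notation kar := (kar hk).
Local Notation kob := (kob hk).

Section Object.
Variable X : complex D.

Definition trunc_ob s n : D :=
  match s with 0 => zob | 1 => kob (cd X n) | _.+2 => X n end.
Definition trunc_ι s n : hom (trunc_ob s n) (trunc_ob s.+1 n) :=
  match s with 0 => 0 | 1 => kar (cd X n) | _.+2 => idm (X n) end.
Definition trunc_d s n : hom (trunc_ob s.+1 n) (trunc_ob s (n - 1)) :=
  match s with
  | 0 => 0 | 1 => divm (kar (cd X (n - 1))) (cd X n) | _.+2 => cd X n end.

Lemma trunc_dd s n : trunc_d s (n - 1) ∘ trunc_d s.+1 n = 0.
Proof.
case: s => [|[|s]] /=; [exact: comp0m| |exact: cdd].
by apply: kar_monic; rewrite compA kar_divm ?cdd ?compm0.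
Qed.

Lemma trunc_ιd s n : trunc_ι s (n - 1) ∘ trunc_d s n = trunc_d s.+1 n ∘ trunc_ι s.+1 n.
Proof.
case: s => [|[|s]] /=.
- apply: kar_monic; rewrite !comp0m compm0 compA kar_divm ?cdd //.
  by rewrite (karP hk _).1.
- by rewrite kar_divm ?cdd // compm1.
- by rewrite comp1m compm1.
Qed.

Definition trunc : staged D :=
  @Staged D trunc_ob trunc_ι trunc_d (fun n => zob_zero D) trunc_dd trunc_ιd.

Definition trunc_c s n : hom (trunc s n) (X n) :=
  match s return hom (trunc s n) (X n) with
  | 0 => 0 | 1 => kar (cd X n) | _.+2 => idm (X n) end.

Lemma trunc_c_ι s n : trunc_c s.+1 n ∘ sι trunc s n = trunc_c s n.
Proof. by case: s => [|[|s]] /=; rewrite ?compm0 ?comp1m. Qed.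

Lemma trunc_c_d s n : cd X n ∘ trunc_c s.+1 n = trunc_c s (n - 1) ∘ sd trunc s n.
Proof.
case: s => [|[|s]] /=.
- by rewrite compm0 (karP hk _).1.
- by rewrite compm1 kar_divm ?cdd.
- by rewrite comp1m compm1.
Qed.

Definition trunc_cocone : scocone trunc X := SCocone trunc_c_ι trunc_c_d.

Lemma trunc_scolim : is_scolim trunc_cocone.
Proof.
move=> n; apply: seqcolim_unshift; first exact: zob_zero.
apply: seqcolimI => [s|T a b ab|T t tE].
- exact: trunc_c_ι.
- by have := ab 1%N; rewrite /= !compm1.
- exists (t 1%N) => -[|s]; first exact: (tE 0%N).
  elim: s => [|s IH]; first by rewrite /= compm1.
  by have := tE s.+1; rewrite /= compm1 => ->; exact: IH.
Qed.

Lemma trunc_c_monic s n : monic (trunc_c s n).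
Proof.
case: s => [|[|s]] t f g; first by move=> _; apply: to_zero; apply: zob_zero.
- exact: kar_monic.
- by rewrite /= !comp1m.
Qed.

Lemma trunc_c_d_pred s n :
  cd X n ∘ trunc_c s n = trunc_c s.-1 (n - 1) ∘ sd_pred trunc s n.
Proof. by case: s => [|s]; [rewrite /= !compm0|exact: trunc_c_d]. Qed.

Lemma trunc_lift s n t (f : hom t (X n)) :
  (s = 0%N -> cd X n ∘ f = 0) -> exists g, trunc_c s.+1 n ∘ g = f.
Proof.
case: s => [/(_ erefl) df0|s _]; last by exists f; rewrite /= comp1m.
exact: (kernel_lift (karP hk _)).
Qed.

(** Any staged object over [X] maps to the truncations of [X], since its stage
    [1] consists of cycles. *)
Lemma trunc_univ (W : staged D) (c : scocone W X) :
  exists f : smap W trunc, forall s n, trunc_c s n ∘ f s n = c s n.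
Proof.
have fP s n : exists f : hom (W s n) (trunc s n), trunc_c s n ∘ f = c s n.
  case: s => [|s]; first by exists 0; apply: from_zero (so0 _ _).
  apply: trunc_lift => s0; subst s.
  by rewrite sc_d (to_zero (sd W 0%N n) 0 (so0 _ _)) compm0.
pose f s n := sval (cid (fP s n)).
have fE s n : trunc_c s n ∘ f s n = c s n by rewrite /f; case: cid.
unshelve eexists (@SMap D W trunc f _ _); last by [].
- move=> s n; apply: trunc_c_monic.
  by rewrite !compA fE trunc_c_ι fE sc_ι.
- move=> s n; apply: trunc_c_monic.
  by rewrite !compA fE -trunc_c_d -compA fE sc_d.
Qed.

End Object.

Definition trunc_map_at X Y (f : chain_map X Y) s n :
    hom (trunc X s n) (trunc Y s n) :=
  match s return hom (trunc X s n) (trunc Y s n) with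
  | 0 => idm _ | 1 => divm (kar (cd Y n)) (f n ∘ kar (cd X n)) | _.+2 => f n end.

Lemma trunc_map_c X Y (f : chain_map X Y) s n :
  trunc_c Y s n ∘ trunc_map_at f s n = f n ∘ trunc_c X s n.
Proof.
case: s => [|[|s]] /=; rewrite ?compm0 ?comp0m ?compm1 ?comp1m //.
by rewrite kar_divm // compA cmP -compA (karP hk _).1 compm0.
Qed.

Definition trunc_map X Y (f : chain_map X Y) : smap (trunc X) (trunc Y).
Proof.
refine (@SMap D _ _ (trunc_map_at f) _ _) => s n; apply: trunc_c_monic.
- by rewrite !compA trunc_map_c -compA trunc_c_ι trunc_c_ι trunc_map_c.
- rewrite !compA trunc_map_c -compA -trunc_c_d -trunc_c_d -compA trunc_map_c.
  by rewrite !compA cmP.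
Defined.

Lemma local_qis_trunc X Y (f : chain_map X Y) :
  acyclic (cone f) -> local_qis (trunc_map f).
Proof.
move=> ac s n t y x e1 e2.
have [|t' [e [u [ee uE]]]] := acyclic_local ac (n := n)
  (b := pairm (trunc_c Y _ _ ∘ y) (trunc_c X _ _ ∘ x)).
  rewrite cone_dE; apply: bip_ext_to; rewrite compm0 compA ?prl_pairm ?prr_pairm.
  - rewrite copairm_pairm !compA trunc_c_d -trunc_map_c -!compA -compDr.
    by rewrite e1 compm0.
  - by rewrite compNm -compA prr_pairm compA trunc_c_d_pred -compA e2 compm0 oppr0.
rewrite cone_dE in uE.
have u1 : cd Y n ∘ (prl ∘ u) + f (n - 1) ∘ (prr ∘ u) = trunc_c Y s.+1 (n - 1) ∘ y ∘ e.
  have := congr1 (comp prl) uE; rewrite (compA prl) (compA prl) !prl_pairm.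
  by rewrite /copairm compDl -!compA.
have u2 : cd X (n - 1) ∘ (prr ∘ u) = - (trunc_c X s (n - 1 - 1) ∘ x ∘ e).
  have := congr1 (comp prr) uE; rewrite (compA prr) (compA prr) !prr_pairm.
  by rewrite compNm -!compA => <-; rewrite opprK.
have [|x' x'E] := @trunc_lift X s (n - 1) t' (prr ∘ u).
  by move=> s0; subst s; rewrite u2 /= !comp0m oppr0.
exists t', e, (prl ∘ u), x'; split=> //; apply: trunc_c_monic.
- rewrite compDr !compA -trunc_c_d trunc_map_c -u1.
  by rewrite compm1 -!compA x'E.
- by rewrite compA -trunc_c_d -compA x'E u2 compmN compA.
Qed.

End Truncation.

(** * The resolution of a staged object *)

Section Resolution.
Variable D : exactCat.
Hypothesis hk : has_kernels D.
Local Notation kar := (kar hk).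
Local Notation kob := (kob hk).
Variable S : D -> Prop.
Variable Q : functor D (full_sub S).
Variable eta : nat_trans (compF (inclF S) Q) (idF D).
Hypothesis eta_epi : forall x : D, adm_epi (eta x).

Definition cov x : D := sval (Q x).
Definition cov_map x y (f : hom x y) : hom (cov x) (cov y) := fmap Q f.
Definition cov_epi x : hom (cov x) x := eta x.

Lemma cov_nat x y (f : hom x y) : cov_epi y ∘ cov_map f = f ∘ cov_epi x.
Proof. exact: ntP eta x y f. Qed.

Lemma cov_map1 x : cov_map (idm x) = idm (cov x).
Proof. exact: fmap1 Q x. Qed.

Lemma cov_mapM x y z (g : hom y z) (f : hom x y) :
  cov_map (g ∘ f) = cov_map g ∘ cov_map f.
Proof. exact: fmapM Q _ _ _ g f. Qed.

(** Stage [s] of the resolution, together with the preceding one. *)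
Record level (Y : staged D) (s : nat) := Level {
  lp : int -> D;
  lc : int -> D;
  ld : forall n, hom (lc n) (lp (n - 1));
  lq : forall n, hom (lc n) (Y s n);
  lι : forall n, hom (lp n) (lc n) }.

Definition cyc_map Y s (l : level Y s) n :
    hom (Y s.+1 n ⊕ lc l (n - 1)) (Y s (n - 1) ⊕ lp l (n - 1 - 1)) :=
  pairm (copairm (sd Y s n) (lq l (n - 1))) (- (ld l (n - 1) ∘ prr)).

(** Each new generator kills a cycle [(y, w)] of the cone: it is sent to [y] by
    the augmentation and to [- w] by the differential. *)
Definition next_level Y s (l : level Y s) : level Y s.+1 :=
  @Level Y s.+1 (lc l) (fun n => lc l n ⊕ cov (kob (cyc_map l n)))
    (fun n => copairm (lι l (n - 1) ∘ ld l n)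
      (- (prr ∘ kar (cyc_map l n) ∘ cov_epi _)))
    (fun n => copairm (sι Y s n ∘ lq l n)
      (prl ∘ kar (cyc_map l n) ∘ cov_epi _))
    (fun n => inl_).

Fixpoint res_level Y s : level Y s :=
  match s return level Y s with
  | 0 => @Level Y 0 (fun _ => zob) (fun _ => zob) (fun _ => 0) (fun _ => 0)
           (fun _ => 0)
  | s'.+1 => next_level (res_level Y s')
  end.

Section Object.
Variable Y : staged D.
Local Notation L s := (res_level Y s).

Lemma cyc_map_l s n : sd Y s n ∘ (prl ∘ kar (cyc_map (L s) n)) =
  - (lq (L s) (n - 1) ∘ (prr ∘ kar (cyc_map (L s) n))).
Proof.
have := congr1 (comp prl) (karP hk (cyc_map (L s) n)).1.
rewrite (compA prl) prl_pairm compm0 /copairm compDl -!compA => /eqP.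
by rewrite addr_eq0 => /eqP.
Qed.

Lemma cyc_map_r s n : ld (L s) (n - 1) ∘ (prr ∘ kar (cyc_map (L s) n)) = 0.
Proof.
have := congr1 (comp prr) (karP hk (cyc_map (L s) n)).1.
rewrite (compA prr) prr_pairm compm0 compNm -!compA => /eqP.
by rewrite oppr_eq0 => /eqP.
Qed.

Lemma res_dd s n : ld (L s.+1) (n - 1) ∘ ld (L s.+2) n = 0.
Proof.
elim: s n => [|s IH] n; apply: bip_ext_from; rewrite comp0m -compA.
all: rewrite ?copairm_inl ?copairm_inr.
- by rewrite compA copairm_inl -compA (from_zero (lι (L 0%N) _) 0 (zob_zero D)) comp0m.
- by rewrite compmN compA cyc_map_r comp0m oppr0.
- by rewrite compA copairm_inl -compA IH compm0.
- by rewrite compmN compA cyc_map_r comp0m oppr0.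
Qed.

Definition res : staged D.
Proof.
refine (@Staged D (fun s n => lc (L s) n) (fun s n => lι (L s.+1) n)
  (fun s n => ld (L s.+1) n) (fun n => zob_zero D) _ _).
- exact: res_dd.
- by move=> s n; rewrite [RHS]copairm_inl.
Defined.

Lemma res_qd s n : lq (L s) (n - 1) ∘ ld (L s.+1) n = sd Y s n ∘ lq (L s.+1) n.
Proof.
elim: s n => [|s IH] n; first exact: to_zero (so0 Y _).
apply: bip_ext_from; rewrite -!compA.
- rewrite !copairm_inl (compA (lq _ _)) [X in X ∘ _ = _]copairm_inl.
  by rewrite -(compA (sι _ _ _)) IH !compA sιd.
- by rewrite !copairm_inr compA cyc_map_l compmN compNm !compA.
Qed.

Definition res_q : smap res Y.
Proof.
refine (@SMap D res Y (fun s n => lq (L s) n) _ _).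
- by move=> s n; rewrite [LHS]copairm_inl.
- exact: res_qd.
Defined.

Lemma res_split : stage_split S res.
Proof.
move=> s n; apply: (SplitMono (svalP (Q (kob (cyc_map (L s) n))))).
exact: biproduct_bip.
Qed.

Lemma res_local_qis : local_qis res_q.
Proof.
move=> s n t y x e1 e2.
have [u uE] : exists u, kar (cyc_map (L s) (n - 1)) ∘ u = pairm y x.
  apply: (kernel_lift (karP hk _)).
  apply: bip_ext_to; rewrite compm0 compA ?prl_pairm ?prr_pairm.
    by rewrite copairm_pairm e1.
  rewrite compNm -compA prr_pairm.
  by case: s x y e1 e2 => [|s] x y e1 /= e2; rewrite ?e2 ?comp0m oppr0.
have [t' [e [v [[vE _] ee]]]] := adm_epi_pullback u (eta_epi _).
exists t', e, 0, (inr_ ∘ v); rewrite compm0 add0r.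
have vE' : cov_epi _ ∘ v = u ∘ e by rewrite vE.
split=> //.
- rewrite compA [X in X ∘ _]copairm_inr -!compA vE' (compA _ u) uE.
  by rewrite compA prl_pairm.
- rewrite compA [X in X ∘ _]copairm_inr compNm -!compA vE' (compA _ u) uE.
  by rewrite compA prr_pairm.
Qed.

End Object.

Fixpoint res_map_at Y Y' (f : smap Y Y') s n : hom (res Y s n) (res Y' s n) :=
  match s return hom (res Y s n) (res Y' s n) with
  | 0 => idm _
  | s'.+1 => bimap (res_map_at f s' n)
     (cov_map (divm (kar (cyc_map (res_level Y' s') n))
        (bimap (f s'.+1 n) (res_map_at f s' (n - 1)) ∘
         kar (cyc_map (res_level Y s') n))))
  end.

Section Map.
Variables (Y Y' : staged D) (f : smap Y Y').
Local Notation L s := (res_level Y s).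
Local Notation L' s := (res_level Y' s).
Local Notation m := (res_map_at f).

Definition res_map_pred s n : hom (lp (L s) n) (lp (L' s) n) :=
  match s return hom (lp (L s) n) (lp (L' s) n) with
  | 0 => idm _ | s'.+1 => m s' n end.

Lemma res_map_ι_pred s n : m s n ∘ lι (L s) n = lι (L' s) n ∘ res_map_pred s n.
Proof. by case: s => [|s] /=; [rewrite compm0 comp0m|rewrite bimap_inl]. Qed.

Definition res_map_compat s :=
  (forall n, lq (L' s) n ∘ m s n = f s n ∘ lq (L s) n) /\
  (forall n, ld (L' s) n ∘ m s n = res_map_pred s (n - 1) ∘ ld (L s) n).

Lemma res_map_cyc s n : res_map_compat s ->
  kar (cyc_map (L' s) n) ∘ divm (kar (cyc_map (L' s) n))
    (bimap (f s.+1 n) (m s (n - 1)) ∘ kar (cyc_map (L s) n)) =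
  bimap (f s.+1 n) (m s (n - 1)) ∘ kar (cyc_map (L s) n).
Proof.
move=> [mq md]; apply: kar_divm; rewrite compA.
have -> : cyc_map (L' s) n ∘ bimap (f s.+1 n) (m s (n - 1)) =
    bimap (f s (n - 1)) (res_map_pred s (n - 1 - 1)) ∘ cyc_map (L s) n.
  apply: bip_ext_to; rewrite !compA ?prl_bimap ?prr_bimap ?prl_pairm ?prr_pairm.
  - rewrite -(compA (f _ _)) prl_pairm /copairm (compDl (_ ∘ prl)) (compDr (f _ _)) -!compA.
    by rewrite prl_bimap prr_bimap !compA mq sm_d.
  - rewrite -(compA (res_map_pred _ _)) prr_pairm compNm compmN -!compA.
    by rewrite prr_bimap !compA md.
by rewrite -compA (karP hk _).1 compm0.
Qed.

Lemma res_mapP s : res_map_compat s.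
Proof.
elim: s => [|s IH].
  split=> n; first exact: from_zero (zob_zero D).
  by rewrite /= comp0m compm0.
have [mq md] := IH.
split=> n; rewrite /=; apply: bip_ext_from; rewrite -!compA.
- rewrite bimap_inl compA !copairm_inl -!compA mq !compA.
  by rewrite sm_ι.
- rewrite bimap_inr compA !copairm_inr -!compA cov_nat.
  by rewrite (compA (kar _)) res_map_cyc // !compA prl_bimap.
- rewrite bimap_inl compA !copairm_inl -!compA md !compA.
  by rewrite res_map_ι_pred.
- rewrite bimap_inr compA !copairm_inr compNm compmN -!compA cov_nat.
  by rewrite (compA (kar _)) res_map_cyc // !compA prr_bimap.
Qed.

Definition res_map : smap (res Y) (res Y').
Proof.
refine (@SMap D (res Y) (res Y') m _ _).
- by move=> s n; rewrite [LHS]bimap_inl.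
- by move=> s n; rewrite [RHS](res_mapP s.+1).2.
Defined.

Lemma res_q_nat s n : res_q Y' s n ∘ res_map s n = f s n ∘ res_q Y s n.
Proof. exact: (res_mapP s).1. Qed.

End Map.

Lemma res_map1 Y (f : smap Y Y) : (forall s n, f s n = idm _) ->
  forall s n, res_map f s n = idm _.
Proof.
move=> f1; elim=> [//|s IH] n.
have IH' n' : res_map_at f s n' = idm _ by exact: IH.
rewrite /= IH' -[RHS]bimap1; congr bimap; rewrite -cov_map1; congr cov_map.
apply: kar_monic; rewrite res_map_cyc; last exact: res_mapP.
by rewrite IH' f1 [bimap _ _]bimap1 comp1m compm1.
Qed.

Lemma res_mapM X Y Z (g : smap Y Z) (f : smap X Y) (h : smap X Z) :
  (forall s n, h s n = g s n ∘ f s n) ->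
  forall s n, res_map h s n = res_map g s n ∘ res_map f s n.
Proof.
move=> hE; elim=> [|s IH] n; first by rewrite /= comp1m.
have IH' n' : res_map_at h s n' = res_map_at g s n' ∘ res_map_at f s n' by exact: IH.
rewrite /= bimap_comp IH'; congr bimap; rewrite -cov_mapM; congr cov_map.
apply: kar_monic; rewrite res_map_cyc; last exact: res_mapP.
rewrite compA res_map_cyc; last exact: res_mapP.
rewrite -compA res_map_cyc; last exact: res_mapP.
by rewrite compA bimap_comp hE IH'.
Qed.

End Resolution.

(** * Kan extensions along localizations *)

Lemma is_iso_fmap (C D : category) (F : functor C D) (x y : C) (f : hom x y) :
  is_iso f -> is_iso (fmap F f).
Proof. by move=> [g [gf fg]]; exists (fmap F g); rewrite -!fmapM gf fg !fmap1. Qed.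

Lemma is_iso_split (C : category) (x y : C) (f : hom x y) (l r : hom y x) :
  l ∘ f = idm x -> f ∘ r = idm y -> is_iso f.
Proof.
by move=> lf fr; exists l; split=> //; rewrite (is_iso_inv_uniq lf fr).
Qed.

Lemma is_iso_cancell (C : category) (x y z : C) (g : hom y z) (f : hom x y) :
  is_iso g -> is_iso (g ∘ f) -> is_iso f.
Proof.
move=> [g' [g1 g2]] [h [h1 h2]].
apply: (@is_iso_split _ _ _ _ (h ∘ g) (h ∘ g)); first by rewrite -compA.
by rewrite -[f ∘ _]comp1m -g1 -!compA (compA f) (compA g) (compA g) h2 comp1m.
Qed.

Lemma is_iso_cancelr (C : category) (x y z : C) (g : hom y z) (f : hom x y) :
  is_iso f -> is_iso (g ∘ f) -> is_iso g.
Proof.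
move=> [f' [f1 f2]] [h [h1 h2]].
apply: (@is_iso_split _ _ _ _ (f ∘ h) (f ∘ h)); last by rewrite compA.
by rewrite -[_ ∘ g]compm1 -f2 !compA -(compA _ g) -(compA f) h1 compm1.
Qed.

Lemma is_iso_monic (C : category) (x y : C) (f : hom x y) : is_iso f -> monic f.
Proof. by move=> [g [gf _]] t a b e; rewrite -[a]comp1m -gf -compA e compA gf comp1m. Qed.

Lemma is_iso_epic (C : category) (x y : C) (f : hom x y) : is_iso f -> epic f.
Proof. by move=> [g [_ fg]] t a b e; rewrite -[a]compm1 -fg compA e -compA fg compm1. Qed.

Section Localization.
Variables (C T : category) (W : mor_class C).

Lemma loc_lift_loc (G : functor C T) (GW : inverts W G) (x y : C) (f : hom x y) :
  fmap (loc_lift GW) (fmap (locF W) f) = fmap G f.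
Proof. exact: (loc_eval_cl GW (loc_map W f)). Qed.

Lemma loc_natural (H K : functor (localization W) T)
    (be : forall x : C, hom (H x) (K x)) :
  (forall (x y : C) (f : hom x y), be y ∘ fmap H (fmap (locF W) f) =
     fmap K (fmap (locF W) f) ∘ be x) ->
  forall (x y : localization W) (u : hom x y), be y ∘ fmap H u = fmap K u ∘ be x.
Proof.
move=> nat x y u; rewrite -[u]loc_reprK; move: (loc_repr u) => {u} a.
elim: a => {x y} [x|x y z a IHa b IHb|x y f|x y w Ww].
- have -> : loc_cl (loc_id W x) = idm (x : localization W) by [].
  by rewrite !fmap1 compm1 comp1m.
- have -> : loc_cl (loc_comp a b) = (loc_cl a : hom (y : localization W) z) ∘
    (loc_cl b : hom (x : localization W) y) by exact: loc_clM.
  by rewrite !fmapM compA IHa -!compA IHb.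
- exact: nat.
- pose v : hom (y : localization W) x := loc_cl (loc_inv Ww).
  have wv : fmap (locF W) w ∘ v = idm (y : localization W).
    by rewrite /= /v -loc_clM; apply/loc_clP/loc_invr.
  have vw : v ∘ fmap (locF W) w = idm (x : localization W).
    by rewrite /= /v -loc_clM; apply/loc_clP/loc_invl.
  rewrite -/v; have Hw : is_iso (fmap H (fmap (locF W) w)).
    by apply: is_iso_fmap; exists v.
  apply: (is_iso_epic Hw); rewrite -compA -fmapM vw fmap1 compm1.
  by rewrite -compA nat compA -fmapM vw fmap1 comp1m.
Qed.

End Localization.

Section Derived.
Variables (C C' : category) (W : mor_class C) (W' : mor_class C').
Variables (F : functor C C') (P : functor C C) (q : nat_trans P (idF C)).
Local Notation G := (compF (locF W') F).
Hypothesis qW : forall X, W (q X).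
Hypothesis GPW : inverts W (compF G P).

Local Notation L := (loc_lift GPW).

(** With [X' := P X] and [γ F] for the localized functor: [γ F (q X')] is a split
    epimorphism for every [X], and [γ F g] is a split monomorphism. By naturality
    of [q] at [g], [γ F g] is also a split epimorphism, hence invertible. *)
Lemma derived_iso :
  (forall X, exists (A : C) (g : hom A (P (P X))),
     is_iso (fmap (locF W) (q (P X) ∘ g)) /\ is_iso (fmap G (q (P X) ∘ g))) ->
  forall X, is_iso (fmap G (q (P X))).
Proof.
move=> cofib.
have split_epi X : exists r, fmap G (q (P X)) ∘ r = idm _.
  have [A [g [_ [h [_ h2]]]]] := cofib X.
  by exists (fmap G g ∘ h); rewrite compA -fmapM.
move=> X; have [A [g [gW gG]]] := cofib X.
have Gg : is_iso (fmap G g).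
  have [h [h1 _]] := gG; have [r rE] := split_epi (P X).
  have [p [_ p2]] : is_iso (fmap G (fmap P g)).
    have -> : fmap G (fmap P g) = fmap L (fmap (locF W) g).
      by apply/esym; exact: (loc_lift_loc GPW).
    apply: (@is_iso_fmap _ _ L _ _ (fmap (locF W) g)); apply: is_iso_cancell (locF_inverts (qW (P X))) _.
    by rewrite -fmapM.
  apply: (@is_iso_split _ _ _ _ (h ∘ fmap G (q (P X))) (fmap G (q A) ∘ p ∘ r)).
    by rewrite -compA -fmapM.
  rewrite !compA -fmapM -(ntP q) fmapM -(compA _ (fmap G (fmap P g))) p2 compm1.
  exact: rE.
by apply: is_iso_cancelr Gg _; rewrite -fmapM.
Qed.

Hypothesis Gq : forall X, is_iso (fmap G (q (P X))).

Lemma total_left_derived : has_total_left_derived W W' F.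
Proof.
have epsP (X Y : C) (f : hom X Y) : fmap G (q Y) ∘ fmap (compF L (locF W)) f =
    fmap G f ∘ fmap G (q X).
  have -> : fmap (compF L (locF W)) f = fmap G (fmap P f) by exact: loc_lift_loc.
  by rewrite -!(fmapM G) (ntP q).
exists L, (@NatTrans C _ (compF L (locF W)) G (fun X => fmap G (q X)) epsP).
move=> H al.
have Hq X : is_iso (fmap H (fmap (locF W) (q X))).
  exact/is_iso_fmap/locF_inverts/qW.
pose v X := sval (cid (Hq X)).
have vq X : v X ∘ fmap H (fmap (locF W) (q X)) = idm _ by rewrite /v; case: cid => ? [].
have qv X : fmap H (fmap (locF W) (q X)) ∘ v X = idm _ by rewrite /v; case: cid => ? [].
pose be (X : C) : hom (H X) (L X) := al (P X) ∘ v X.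
have beP : forall (X Y : localization W) (u : hom X Y),
    be Y ∘ fmap H u = fmap L u ∘ be X.
  apply: loc_natural => X Y f; apply: (is_iso_epic (Hq X)).
  rewrite /be -!compA vq compm1 -!fmapM -(ntP q) !fmapM !(compA (v Y)) vq comp1m.
  have -> : fmap L (fmap (locF W) f) = fmap G (fmap P f) by exact: loc_lift_loc.
  exact: (ntP al).
have beE X : fmap G (q X) ∘ be X = al X.
  rewrite /be compA -(ntP al) -[RHS]compm1 -(qv X) compA; by [].
exists (NatTrans beP); split=> [X|be' be'E]; first exact: beE.
apply: nat_trans_ext => X; apply: (is_iso_epic (Hq X)).
rewrite (ntP (NatTrans beP)) (ntP be'); congr (_ ∘ _).
apply: (is_iso_monic (Gq X)).
by apply: etrans (esym (be'E _)); apply: beE.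
Qed.

End Derived.

(** * Resolving unbounded complexes *)

Section StagedColimit.
Variable A : exactCat.
Implicit Types X Y : staged A.

Definition scocone_pre X Y (f : smap X Y) (T : complex A) (c : scocone Y T) :
  scocone X T.
Proof.
refine (@SCocone A X T (fun s n => c s n ∘ f s n) _ _) => s n.
- by rewrite -compA sm_ι compA sc_ι.
- by rewrite compA sc_d -!compA sm_d.
Defined.

Lemma scolim_ext X T (c : scocone X T) T' (φ ψ : chain_map T T') :
  is_scolim c -> (forall s n, φ n ∘ c s n = ψ n ∘ c s n) -> φ = ψ.
Proof.
by move=> C e; apply: chain_map_ext => n; apply: (seqcolim_ext (C n)) => s.
Qed.

Lemma scolim_desc X T (c : scocone X T) T' (k : scocone X T') :
  is_scolim c -> exists φ : chain_map T T', forall s n, φ n ∘ c s n = k s n.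
Proof.
move=> C.
have φP n : exists h : hom (T n) (T' n), forall s, h ∘ c s n = k s n.
  by apply: (seqcolim_desc (C n)) => s; rewrite sc_ι.
pose φ n := sval (cid (φP n)).
have φE n s : φ n ∘ c s n = k s n by rewrite /φ; case: cid.
have φd n : cd T' n ∘ φ n = φ (n - 1) ∘ cd T n.
  apply: (seqcolim_ext (seqcolimS (C n))) => s.
  by rewrite -compA φE -compA !sc_d compA φE.
by exists (ChainMap φd) => s n; apply: φE.
Qed.

Lemma scolim_exists X : weakly_omega_elementary A ->
  (forall s n, adm_mono (sι X s n)) ->
  exists (T : complex A) (c : scocone X T), is_scolim c.
Proof.
move=> elem Xm.
have CP n : exists L : {L : A & forall s, hom (X s n) L},
    seqcolim (fun s => sι X s n) (projT2 L).
  by have [L [k Lk]] := seqcolim_exists elem (fun s => Xm s n); exists (existT _ L k).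
pose T n := projT1 (sval (cid (CP n))).
pose c s n : hom (X s n) (T n) := projT2 (sval (cid (CP n))) s.
have C n : seqcolim (fun s => sι X s n) (fun s => c s n).
  by rewrite /c /T; case: cid.
have dP n : exists d, forall s, d ∘ c s.+1 n = c s (n - 1) ∘ sd X s n.
  apply: (seqcolim_desc (seqcolimS (C n))) => s.
  by rewrite -compA -sιd compA (C _).1.
pose d n := sval (cid (dP n)).
have dE n s : d n ∘ c s.+1 n = c s (n - 1) ∘ sd X s n by rewrite /d; case: cid.
have dd n : d (n - 1) ∘ d n = 0.
  apply: (seqcolim_ext (seqcolimS (seqcolimS (C n)))) => s.
  by rewrite -compA dE compA dE -compA sdd compm0 comp0m.
by exists (Complex dd), (@SCocone A X (Complex dd) c (fun s n => (C n).1 s)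
  (fun s n => dE n s)).
Qed.

End StagedColimit.

Section DerivedFunctor.
Variables (D E : exactCat) (F : additiveFunctor D E) (S : D -> Prop).
Hypotheses (wicD : weakly_idempotent_complete D)
  (wicE : weakly_idempotent_complete E).
Hypotheses (elemD : weakly_omega_elementary D)
  (elemE : weakly_omega_elementary E).
Hypothesis hk : has_kernels D.
Hypothesis proj : projective_subcat F S.
Hypothesis pres : preserves_countable_coproducts F S.
Variables (Q : functor D (full_sub S)).
Variable eta : nat_trans (compF (inclF S) Q) (idF D).
Hypothesis eta_epi : forall x : D, adm_epi (eta x).

Local Notation res := (res hk eta).
Local Notation res_map := (res_map hk eta).
Local Notation res_q := (res_q hk eta).
Local Notation trunc := (trunc hk).
Local Notation trunc_map := (trunc_map hk).
Local Notation trunc_cocone := (trunc_cocone hk).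

Lemma res_S Y s n : S (res Y s n).
Proof.
elim: s n => [|s IH] n; first exact: proj_zob proj.
by apply: (proj_bip proj); [exact: IH|exact: svalP].
Qed.

Lemma stage_split_adm_mono (Y : staged D) : stage_split S Y ->
  forall s n, adm_mono (sι Y s n).
Proof. by move=> sp s n; apply: adm_mono_biproduct (split_bip (sp s n)). Qed.

Lemma res_colim_exists Y : exists T (c : scocone (res Y) T), is_scolim c.
Proof. exact/scolim_exists/stage_split_adm_mono/res_split. Qed.

Lemma local_qis_scolim (X Y : staged D) (f : smap X Y) :
  (forall s n, S (X s n)) -> (forall s n, S (Y s n)) ->
  stage_split S X -> stage_split S Y -> local_qis f ->
  forall T T' (c : scocone X T) (c' : scocone Y T') (φ : chain_map T T'),
  is_scolim c -> is_scolim c' -> (forall s n, φ n ∘ c s n = c' s n ∘ f s n) ->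
  acyclic (cone φ) /\ acyclic (cone (fmap (ChF F) φ)).
Proof.
move=> SX SY spX spY /local_qis_slocal/(slocal_sexact hk) ex T T' c c' φ C C' φc.
have sp := stage_split_scone (proj_bip proj) f SX SY spX spY.
have CC := scone_scolim φc C C'; split.
  by apply: (acyclic_scolim wicD elemD _ CC ex) => s n; apply: stage_split_adm_mono.
apply: acyclic_cone_map.
apply: (acyclic_map_scolim wicE elemE proj pres _ sp CC ex) => -[|s] n.
  exact: proj_zob proj.
exact: (proj_bip proj).
Qed.

Definition resolve (X : complex D) : complex D := sval (cid (res_colim_exists (trunc X))).
Definition resolve_cocone (X : complex D) : scocone (res (trunc X)) (resolve X) :=
  sval (cid (svalP (cid (res_colim_exists (trunc X))))).
Lemma resolve_scolim X : is_scolim (resolve_cocone X).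
Proof. exact: svalP (cid (svalP (cid (res_colim_exists (trunc X))))). Qed.

Definition resolve_map X Y (f : chain_map X Y) : chain_map (resolve X) (resolve Y) :=
  sval (cid (scolim_desc (scocone_pre (res_map (trunc_map f)) (resolve_cocone Y)) (resolve_scolim X))).

Lemma resolve_mapE X Y (f : chain_map X Y) s n :
  resolve_map f n ∘ resolve_cocone X s n = resolve_cocone Y s n ∘ res_map (trunc_map f) s n.
Proof. by rewrite /resolve_map; case: cid. Qed.

Definition resolution : functor (Ch D) (Ch D).
Proof.
refine (@Functor (Ch D) (Ch D) resolve resolve_map _ _).
- move=> X; apply: (scolim_ext (resolve_scolim X)) => s n.
  rewrite resolve_mapE res_map1 ?compm1 ?comp1m // => s' n'.
  by apply: trunc_c_monic; rewrite trunc_map_c comp1m compm1.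
- move=> X Y Z g f; apply: (scolim_ext (resolve_scolim X)) => s n.
  rewrite resolve_mapE /= -compA resolve_mapE compA resolve_mapE -compA; congr (_ ∘ _).
  apply: res_mapM => s' n'; apply: trunc_c_monic.
  by rewrite compA !trunc_map_c -!compA trunc_map_c.
Defined.

Definition augment_at X : chain_map (resolve X) X :=
  sval (cid (scolim_desc (scocone_pre (res_q (trunc X)) (trunc_cocone X)) (resolve_scolim X))).

Lemma augment_atE X s n :
  augment_at X n ∘ resolve_cocone X s n = trunc_cocone X s n ∘ res_q (trunc X) s n.
Proof. by rewrite /augment_at; case: cid. Qed.

Definition augment : nat_trans resolution (idF (Ch D)).
Proof.
refine (@NatTrans _ _ resolution (idF (Ch D)) augment_at _) => X Y f.
apply: (scolim_ext (resolve_scolim X)) => s n /=.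
rewrite -compA resolve_mapE compA augment_atE -!compA augment_atE res_q_nat !compA.
by rewrite [X in X ∘ _ = _]trunc_map_c.
Defined.

Lemma augment_qis X : quasi_iso (augment X).
Proof.
have CC := scone_scolim (@augment_atE X) (resolve_scolim X) (trunc_scolim hk X).
have loc := local_qis_slocal (@res_local_qis _ hk _ _ _ eta_epi (trunc X)).
apply: (acyclic_scolim wicD elemD _ CC (slocal_sexact hk loc)) => s n.
apply: adm_mono_biproduct (biproduct_bimap (biproduct_id _) (biproduct_bip _ _)).
Qed.

Lemma resolution_qis X Y (f : chain_map X Y) : quasi_iso (f : hom (X : Ch D) Y) ->
  quasi_iso (fmap (ChF F) (fmap resolution f)).
Proof.
move=> qf; apply: (proj2 (local_qis_scolim (f := res_map (trunc_map f))
  (@res_S _) (@res_S _) (@res_split _ _ _ _ _ _) (@res_split _ _ _ _ _ _) _ (resolve_scolim X) (resolve_scolim Y) _)).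
- apply: (local_qis_cancel (q := res_q _) (q' := res_q _) (h := trunc_map f)).
  + exact: res_q_nat.
  + exact: res_local_qis.
  + exact: res_local_qis.
  + exact: local_qis_trunc.
- by move=> s n; rewrite [LHS]resolve_mapE.
Qed.

(** The colimit of the resolution of [res (trunc X)] maps to the resolution of
    [resolve X], because [res (trunc X)] maps to the truncations of [resolve X]. *)
Lemma resolution_cofibrant (X : Ch D) : exists (A : Ch D) (g : hom A (resolution (resolution X))),
  quasi_iso (augment (resolution X) ∘ g) /\ quasi_iso (fmap (ChF F) (augment (resolution X) ∘ g)).
Proof.
have [u uE] := trunc_univ hk (resolve_cocone X).
have [A [c C]] := res_colim_exists (res (trunc X)).
have [g gE] := scolim_desc (scocone_pre (res_map u) (resolve_cocone (resolve X))) C.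
exists A, g; apply: (local_qis_scolim (@res_S _) (@res_S _)
  (@res_split _ _ _ _ _ _) (@res_split _ _ _ _ _ _) (@res_local_qis _ hk _ _ _ eta_epi _)
  C (resolve_scolim X)) => s n.
rewrite -[LHS]compA gE [LHS]compA augment_atE -compA res_q_nat compA.
by rewrite [trunc_cocone _ _ _ ∘ _]uE.
Qed.

Lemma derived_functor_exists :
  has_total_left_derived (@quasi_iso D) (@quasi_iso E) (ChF F).
Proof.
have GPW : inverts (@quasi_iso D) (compF (compF (locF (@quasi_iso E)) (ChF F)) resolution).
  by move=> X Y f qf; apply: locF_inverts; apply: resolution_qis.
apply: (total_left_derived augment_qis GPW); apply: (derived_iso augment_qis GPW) => X.
have [A [g [g1 g2]]] := resolution_cofibrant X.
by exists A, g; split; apply: locF_inverts.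
Qed.

End DerivedFunctor.

Theorem theorem0p1 (D E : exactCat) (F : additiveFunctor D E) (S : D -> Prop) :
  weakly_idempotent_complete D -> weakly_idempotent_complete E ->
  weakly_omega_elementary D -> weakly_omega_elementary E ->
  has_kernels D ->
  projective_subcat F S ->
  preserves_countable_coproducts F S ->
  has_total_left_derived (@quasi_iso D) (@quasi_iso E) (ChF F).
Proof.
move=> wicD wicE elemD elemE hk proj pres.
have [Q [eta eta_epi]] := proj_cover proj.
exact: (derived_functor_exists wicD wicE elemD elemE hk proj pres eta_epi).
Qed.
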